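(* Let $\mathcal C$ be a small category satisfying the nine axioms (A1)–(A9), and choose a linear order on each derived input-place set $P_\phi$, $\phi\in\Phi$. There is a free non-symmetric operad $\mathcal O_{\mathcal C}$ on the derived ranked set $\Phi$ (with arity function $\phi\mapsto|P_\phi|$) with the following description. (a) Its operations of arity $n$ are the objects $X$ of $\mathcal C$ with exactly $n$ points. Its identity operation is $1$. (b) If the points of $X$ are $j_1<\cdots<j_n$, the composite $\gamma(X;A_1,\ldots,A_n)$ is the universal filling of $A_i$ at $j_i$ for $1\le i\le n$. Its input list is obtained by concatenating the ordered input lists (ordered lists of points) of $A_1,\ldots,A_n$. (c) The category $\mathcal C$ is isomorphic to the prefix–suffix matching category of the operations of $\mathcal O_{\mathcal C}$. The isomorphism class of this operad is independent of the chosen orders. Moreover, if $\mathcal C$ is the expression tree category of a free non-symmetric operad, that operad is recovered up to isomorphism, i.e. it is isomorphic to $\mathcal O_{\mathcal C}$.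
   Context: AXIOMS. Let $\mathcal C$ be a small category. A monomorphism $m:A\to B$ is strong if for every epimorphism $e:P\to Q$ and all $a:P\to A$, $b:Q\to B$ with $ma=be$ there is $\ell:Q\to A$ with $\ell e=a$ and $m\ell=b$. The nine axioms are: (A1) There is a terminal object $1$ (fixed); $q_X:X\to 1$ is the unique morphism, and a point of $Y$ is a morphism $1\to Y$. (A2) Every morphism factors as $me$ with $e$ an epimorphism and $m$ a strong monomorphism. (A3) For every epimorphism $d:X\to Y$ and strong monomorphism $v:B\to Y$ the pullback of $d$ and $v$ exists and its projection to $B$ is an epimorphism. (A4) For every strong monomorphism $u:A\to X$ and epimorphism $a:A\to B$ there is a pushout square $cu=va$ ($c:X\to Y$, $v:B\to Y$) with $v$ a strong monomorphism, and this square is also a pullback. (A5) The class of epimorphisms whose pullbacks along all but at most one point of their codomain are isomorphisms is stable under pushout along strong monomorphisms. (A6) For every object $A$ and point $j:1\to B$ the category $\mathcal F(A,j)$ has a terminal object. Its objects are triples $(C,d,u)$ with $u:A\to C$ a strong monomorphism and $d:C\to B$ an epimorphism such that the square $du=jq_A$ is a pullback; its morphisms $(C',d',u')\to(C,d,u)$ are morphisms $h:C'\to C$ with $hu'=u$ and $dh=d'$. (A7) For every object $X$ there are finitely many strong monomorphisms with codomain $X$ and finitely many epimorphisms with domain $X$ (counted as individual arrows, with all possible other endpoints). (A8) For every commutative square of strong monomorphisms $ca=db$ ($a:W\to X$, $b:W\to Y$, $c:X\to Z$, $d:Y\to Z$) there is $h:X\to Y$ with $ha=b$, $dh=c$, or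 there is $k:Y\to X$ with $kb=a$, $ck=d$. (A9) If the pullback of an epimorphism $d:X\to Y$ along every point of $Y$ is an isomorphism, then $d$ is an identity. Here ''the pullback of $d$ along a point $j:1\to Y$'' is the projection $X\times_Y1\to1$. NOTATION (under the axioms). Every isomorphism is an identity, points are strong monomorphisms, and every morphism factors uniquely as an epimorphism followed by a strong monomorphism (normal factorization). $\mathrm S(X)$ is the finite set of all strong monomorphisms into $X$. A strong monomorphism $i:A\to X$ is indecomposable if it is not an identity and whenever $i=vu$ with $u,v$ strong monomorphisms, $u$ or $v$ is an identity; $\operatorname{Comp}(X)$ is the set of indecomposable strong monomorphisms $i:X_i\to X$. Let $\mathcal E^\circ$ consist of the epimorphisms with codomain $\neq1$ together with $\mathrm{id}_1$. For $d:X\to Y$ in $\mathcal E^\circ$, $X\ne1$, the map $\sigma_d:\operatorname{Comp}(X)\to\operatorname{Comp}(Y)$ sending $i$ to the strong monomorphism part of the normal factorization of $di$ is a bijection. An object is normal if its only outgoing morphism in $\mathcal E^\circ$ is its identity; every $X$ has a unique $\rho_X:X\to r(X)$ in $\mathcal E^\circ$ with normal target. $\Phi=\{\phi\ne1:r(\phi)=\phi\}$ and $P_\phi=\operatorname{Comp}(\phi)$. Order on points: given linear orders on the $P_\phi$, a linear order on $\mathrm S(X)$ is defined recursively: for $X=1$ it is the unique order; for $X\neq1$ transport the order of $P_{r(X)}$ to $\operatorname{Comp}(X)=\{i_1<\dots<i_n\}$ along $\sigma_{\rho_X}$, and list first the elements $i_1w$ with $w\in\mathrm S(X_{i_1})$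 in the order of $\mathrm S(X_{i_1})$, then those $i_2w$, and so on, and finally $\mathrm{id}_X$. The points of $X$ (its inputs) are ordered by restriction. Universal filling: for objects $A_1,\dots,A_n$ and distinct points $j_1,\dots,j_n$ of $B$, consider the category of tuples $(C,d,(u_i)_i)$ with $d:C\to B$ an epimorphism, $u_i:A_i\to C$ strong monomorphisms and each square $du_i=j_iq_{A_i}$ a pullback; morphisms $(C',d',(u_i'))\to(C,d,(u_i))$ are $h:C'\to C$ with $dh=d'$ and $hu_i'=u_i$ for all $i$. Its terminal object (which exists and is unique) is the universal filling; the composite operation is its object $C$, whose points are the $u_ik$ with $k$ a point of $A_i$. OPERADS. A non-symmetric operad has sets of operations of each arity $n\geq 0$, an identity operation of arity 1, and a simultaneous composition satisfying the unit and associativity laws. It is free on a ranked set $\Phi$ if it contains $\Phi$ as operations with the given arities and every arity-preserving assignment of $\Phi$ into the operations of any non-symmetric operad $Q$ extends uniquely to an operad map (preserving arity, composition and identity). EXPRESSION TREE CATEGORIES. A ranked set is a set $L$ with a function $\operatorname{ar}:L\to\mathbb N$. Trees over $L$: the empty leaf $1$ is a tree, and for $\lambda\in L$, $n=\operatorname{ar}(\lambda)$ and trees $T_1,\dots,T_n$ there is a tree $\lambda(T_1,\dots,T_n)$; equality is syntactic. The operations of arity $n$ of the free non-symmetric operad on $L$ are the trees with exactly $n$ empty leaves, composed by grafting into the empty leaves from left to right. Positions: $\operatorname{Pos}(1)=\{()\}$, and $\operatorname{Pos}(\lambda(T_1,\dots,T_n))$ consists of the empty word and the words $pb$ with $1\le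 p\le n$, $b\in\operatorname{Pos}(T_p)$; $X|_a$ is the entire subtree at $a$. An occurrence $A\to X$ is a position $a$ with $X|_a=A$; occurrences compose by concatenating addresses. $T$ is obtainable from $X$ by pruning if $T=1$, or $X=\lambda(X_1,\dots,X_n)$ and $T=\lambda(T_1,\dots,T_n)$ with each $T_p$ obtainable from $X_p$; then there is exactly one pruning map $d:X\to T$ (otherwise none), $\operatorname{Pos}(T)\subseteq\operatorname{Pos}(X)$, and $p_d$ sends a position of $X$ to its longest prefix in $\operatorname{Pos}(T)$. The expression tree category (prefix–suffix matching category) $\mathcal C_L$ has trees as objects; a morphism $X\to Y$ is a pair $(d,u)$ of a pruning map $d:X\to T$ and an occurrence $u:T\to Y$. For $(d,u):X\to Y$ with $u$ at address $a$ and $(e,v):Y\to Z$ with $e:Y\to S$, the composite is $(e_ad,vu')$, where $u'$ is the occurrence of $S|_{p_e(a)}$ in $S$ at $p_e(a)$ and $e_a:Y|_a\to S|_{p_e(a)}$ is the pruning map. Identities are the pairs of identities. This is the expression tree category of the free operad on $L$, i.e. the prefix–suffix matching category of its operations. *)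

(* Defs.v *)
From Stdlib Require List.
From Stdlib Require Import Sorting.Sorted Eqdep.
From mathcomp Require Import all_boot.
From mathcomp Require Import boolp classical_sets functions cardinality.

Set Implicit Arguments.
Unset Strict Implicit.
Unset Printing Implicit Defensive.

Local Open Scope classical_set_scope.
Local Open Scope card_scope.

(** * Categories *)

Record category := Category {
  ob :> Type;
  hom : ob -> ob -> Type;
  idm : forall X, hom X X;
  cmp : forall X Y Z, hom Y Z -> hom X Y -> hom X Z;
  cmp1m : forall X Y (f : hom X Y), cmp (idm Y) f = f;
  cmpm1 : forall X Y (f : hom X Y), cmp f (idm X) = f;
  cmpA : forall W X Y Z (f : hom Y Z) (g : hom X Y) (h : hom W X),
    cmp f (cmp g h) = cmp (cmp f g) h
}.

Arguments hom {c} X Y.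
Arguments idm {c} X.
Arguments cmp {c X Y Z}.

Notation "g '∘' f" := (cmp g f) (at level 40, left associativity).

Definition cat_isomorphic (C D : category) : Prop :=
  exists (F : C -> D) (Fm : forall X Y : C, hom X Y -> hom (F X) (F Y)),
    [/\ bijective F,
        (forall X Y : C, bijective (@Fm X Y)),
        (forall X : C, Fm X X (idm X) = idm (F X)) &
        (forall (X Y Z : C) (g : hom Y Z) (f : hom X Y),
            Fm X Z (g ∘ f) = Fm Y Z g ∘ Fm X Y f)].

Section Morphisms.
Variable C : category.
Implicit Types X Y Z A B P Q W : C.

(* [is_id f]: the source and target of [f] are equal and [f] is the
   identity. *)
Inductive is_id X : forall Y, hom X Y -> Prop := IsId : is_id (idm X).

Definition is_iso X Y (f : hom X Y) : Prop :=
  exists g : hom Y X, g ∘ f = idm X /\ f ∘ g = idm Y.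

Definition epi X Y (f : hom X Y) : Prop :=
  forall Z (g h : hom Y Z), g ∘ f = h ∘ f -> g = h.

Definition mono X Y (f : hom X Y) : Prop :=
  forall Z (g h : hom Z X), f ∘ g = f ∘ h -> g = h.

Definition strong_mono A B (m : hom A B) : Prop :=
  mono m /\
  forall P Q (e : hom P Q), epi e -> forall (a : hom P A) (b : hom Q B),
    m ∘ a = b ∘ e -> exists l : hom Q A, l ∘ e = a /\ m ∘ l = b.

(* [p : P -> X] and [r : P -> Y] are the projections of a pullback of
   [f : X -> Z] and [g : Y -> Z]. *)
Definition is_pullback X Y Z (f : hom X Z) (g : hom Y Z)
    P (p : hom P X) (r : hom P Y) : Prop :=
  f ∘ p = g ∘ r /\
  forall W (a : hom W X) (b : hom W Y), f ∘ a = g ∘ b ->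
    exists! h : hom W P, p ∘ h = a /\ r ∘ h = b.

(* [c : X -> P] and [v : Y -> P] are the injections of a pushout of
   [u : Z -> X] and [a : Z -> Y]. *)
Definition is_pushout X Y Z (u : hom Z X) (a : hom Z Y)
    P (c : hom X P) (v : hom Y P) : Prop :=
  c ∘ u = v ∘ a /\
  forall W (f : hom X W) (g : hom Y W), f ∘ u = g ∘ a ->
    exists! h : hom P W, h ∘ c = f /\ h ∘ v = g.

(* Morphisms with a fixed target, and with a fixed source. *)
Record arrow_into X := ArrowInto { src : C; arr : hom src X }.
Record arrow_outof X := ArrowOutof { tgt : C; coarr : hom X tgt }.

Definition extend X (i : arrow_into X) (w : arrow_into (src i)) : arrow_into X :=
  ArrowInto (arr i ∘ arr w).

Definition id_arrow_into X : arrow_into X := ArrowInto (idm X).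

Definition S_ X : set (arrow_into X) := [set u | strong_mono (arr u)].

Definition indecomposable A X (i : hom A X) : Prop :=
  [/\ strong_mono i, ~ is_id i &
      forall B (u : hom A B) (v : hom B X), strong_mono u -> strong_mono v ->
        i = v ∘ u -> is_id u \/ is_id v].

Definition Comp X : set (arrow_into X) := [set i | indecomposable (arr i)].

(* The graph of [sigma_d]: [k] is the strong monomorphism part of a
   factorization of [d ∘ i] as an epimorphism followed by a strong
   monomorphism. *)
Definition sigma X Y (d : hom X Y) (i : arrow_into X) (k : arrow_into Y) : Prop :=
  exists e : hom (src i) (src k),
    [/\ epi e, strong_mono (arr k) & d ∘ arr i = arr k ∘ e].

End Morphisms.

(** * The nine conditions on a category *)

Section Axiomatics.
Variables (C : category) (one : C) (q : forall X : C, hom X one).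
Implicit Types X Y Z A B W : C.

Definition pullback_iso_along X Y (d : hom X Y) (j : hom one Y) : Prop :=
  exists (P : C) (p : hom P X) (r : hom P one), is_pullback d j p r /\ is_iso r.

(* All pullbacks of [d] along points are isomorphisms, with at most one
   exception. *)
Definition one_point_epi X Y (d : hom X Y) : Prop :=
  epi d /\
  forall j k : hom one Y,
    ~ pullback_iso_along d j -> ~ pullback_iso_along d k -> j = k.

(* Fillings of a family of objects [A i] at a family of points [j i]. *)
Definition is_filling (I : Type) B (j : I -> hom one B) (A : I -> C)
    (D : C) (d : hom D B) (u : forall i, hom (A i) D) : Prop :=
  epi d /\
  forall i, strong_mono (u i) /\ is_pullback d (j i) (u i) (q (A i)).

Definition universal_filling (I : Type) B (j : I -> hom one B) (A : I -> C)
    (D : C) (d : hom D B) (u : forall i, hom (A i) D) : Prop :=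
  is_filling j d u /\
  forall (D' : C) (d' : hom D' B) (u' : forall i, hom (A i) D'),
    is_filling j d' u' ->
    exists! h : hom D' D, d ∘ h = d' /\ forall i, h ∘ u' i = u i.

(* In [A6], the category F(A, j) is the category of fillings of a family with
   a single member, indexed by [unit]. *)
Record nine_axioms : Prop := NineAxioms {
  A1 : forall X (f : hom X one), f = q X;
  A2 : forall X Y (f : hom X Y), exists (M : C) (e : hom X M) (m : hom M Y),
    [/\ epi e, strong_mono m & f = m ∘ e];
  A3 : forall X Y B (d : hom X Y) (v : hom B Y), epi d -> strong_mono v ->
    exists (P : C) (p : hom P X) (r : hom P B), is_pullback d v p r /\ epi r;
  A4 : forall A X B (u : hom A X) (a : hom A B), strong_mono u -> epi a ->
    exists (Y : C) (c : hom X Y) (v : hom B Y),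
      [/\ is_pushout u a c v, strong_mono v & is_pullback c v u a];
  A5 : forall A B X Y (a : hom A B) (u : hom A X) (c : hom X Y) (v : hom B Y),
    one_point_epi a -> strong_mono u -> is_pushout u a c v -> one_point_epi c;
  A6 : forall A B (j : hom one B), exists (D : C) (d : hom D B) (u : hom A D),
    universal_filling (fun _ : unit => j) (A := fun _ => A) d (fun _ => u);
  A7 : forall X, finite_set (@S_ C X) /\
    finite_set [set d : arrow_outof X | epi (coarr d)];
  A8 : forall W X Y Z (a : hom W X) (b : hom W Y) (c : hom X Z) (d : hom Y Z),
    strong_mono a -> strong_mono b -> strong_mono c -> strong_mono d ->
    c ∘ a = d ∘ b ->
    (exists h : hom X Y, h ∘ a = b /\ d ∘ h = c) \/
    (exists k : hom Y X, k ∘ b = a /\ c ∘ k = d);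
  A9 : forall X Y (d : hom X Y), epi d ->
    (forall j : hom one Y, pullback_iso_along d j) -> is_id d
}.

(** * Derived ranked set and order on inputs *)

Definition Ecirc X Y (d : hom X Y) : Prop :=
  (epi d /\ Y <> one) \/ (is_id d /\ Y = one).

Definition normal X : Prop := forall Y (d : hom X Y), Ecirc d -> is_id d.

Definition is_reduction X N (rho : hom X N) : Prop := Ecirc rho /\ normal N.

(* The second conjunct is the equation r(phi) = phi. *)
Definition is_letter (phi : C) : Prop :=
  phi <> one /\ exists rho : hom phi phi, is_reduction rho.

Definition linear_order_on (T : Type) (E : set T) (R : T -> T -> Prop) : Prop :=
  [/\ (forall x, E x -> ~ R x x),
      (forall x y z, E x -> E y -> E z -> R x y -> R y z -> R x z) &
      (forall x y, E x -> E y -> [\/ R x y, x = y | R y x])].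

(* A (strict) linear order on each P_phi; the values of [R] elsewhere are
   irrelevant. *)
Definition linear_orders
    (R : forall phi : C, arrow_into phi -> arrow_into phi -> Prop) : Prop :=
  forall phi, is_letter phi -> linear_order_on (@Comp C phi) (R phi).

Section Order.
Variable R : forall phi : C, arrow_into phi -> arrow_into phi -> Prop.

(* The order on [Comp X] transported from the order on the components of r(X)
   along [sigma]; it is only used for X <> 1, where r(X) is a letter. *)
Definition comp_lt X (i i' : arrow_into X) : Prop :=
  [/\ Comp i, Comp i' &
    exists (phi : C) (rho : hom X phi) (k k' : arrow_into phi),
      [/\ is_reduction rho, Comp k, Comp k' & is_letter phi] /\
      [/\ sigma rho i k, sigma rho i' k' & R k k']].

(* The strict order on S(X), as an inductive relation.  There is no clause for
   X = 1, where S(X) is a singleton. *)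
Inductive sub_lt : forall X, arrow_into X -> arrow_into X -> Prop :=
| sub_lt_across X (i i' : arrow_into X) (w : arrow_into (src i)) (w' : arrow_into (src i')) :
    X <> one -> comp_lt i i' -> S_ w -> S_ w' ->
    sub_lt (extend w) (extend w')
| sub_lt_within X (i : arrow_into X) (w w' : arrow_into (src i)) :
    X <> one -> Comp i -> S_ w -> S_ w' -> sub_lt w w' ->
    sub_lt (extend w) (extend w')
| sub_lt_top X (i : arrow_into X) (w : arrow_into (src i)) :
    X <> one -> Comp i -> S_ w ->
    sub_lt (extend w) (id_arrow_into X).

(* [s] is the increasing list of all points of [X]. *)
Definition inputs X (s : seq (hom one X)) : Prop :=
  [/\ StronglySorted
        (fun j k => sub_lt (ArrowInto j) (ArrowInto k)) s,
      List.NoDup s & forall j, List.In j s].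

End Order.

End Axiomatics.

(** * Non-symmetric operads *)

Record ranked_set := RankedSet { label :> Type; rank : label -> nat }.

Arguments rank {r}.

(* A non-symmetric operad whose operations, of all arities together, are the
   elements of [T].  The composite [ocomp x ys] is only meaningful when [ys]
   has as many members as the arity of [x]. *)
Record operad (T : Type) := Operad {
  arity : T -> nat;
  ounit : T;
  ocomp : T -> seq T -> T;
  arity_ounit : arity ounit = 1;
  arity_ocomp : forall x ys, size ys = arity x ->
    arity (ocomp x ys) = sumn [seq arity y | y <- ys];
  ocomp1x : forall x, ocomp ounit [:: x] = x;
  ocompx1 : forall x, ocomp x (nseq (arity x) ounit) = x;
  ocompA : forall x ys zss,
    size ys = arity x -> shape zss = [seq arity y | y <- ys] ->
    ocomp (ocomp x ys) (flatten zss) =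
    ocomp x [seq ocomp p.1 p.2 | p <- zip ys zss]
}.

Definition operad_map T U (O : operad T) (P : operad U) (f : T -> U) : Prop :=
  [/\ (forall x, arity P (f x) = arity O x),
      f (ounit O) = ounit P &
      (forall x ys, size ys = arity O x ->
         f (ocomp O x ys) = ocomp P (f x) [seq f y | y <- ys])].

Definition operad_iso T U (O : operad T) (P : operad U) (f : T -> U) : Prop :=
  operad_map O P f /\
  exists2 g : U -> T, operad_map P O g & cancel f g /\ cancel g f.

Definition operad_isomorphic T U (O : operad T) (P : operad U) : Prop :=
  exists f, operad_iso O P f.

Definition is_free (L : ranked_set) T (O : operad T) (iota : L -> T) : Prop :=
  [/\ injective iota,
      (forall l, arity O (iota l) = rank l) &
      (forall U (Q : operad U) (f : L -> U),
         (forall l, arity Q (f l) = rank l) ->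
         exists2 F : T -> U,
           operad_map O Q F /\ (forall l, F (iota l) = f l) &
           forall G : T -> U,
             operad_map O Q G -> (forall l, G (iota l) = f l) -> G =1 F)].

(** * Trees, the free operad and the expression tree category *)

Section Trees.
Variable L : ranked_set.

Inductive tree :=
| Leaf
| Node (l : L) of ('I_(rank l) -> tree).

Definition corolla (l : L) : tree := @Node l (fun _ => Leaf).

Fixpoint leaves (T : tree) : nat :=
  match T with
  | Leaf => 1
  | Node l ts => sumn [seq leaves (ts i) | i <- enum 'I_(rank l)]
  end.

(* Grafting the trees of [s] into the empty leaves, from left to right: the
   list [s] is cut into consecutive blocks, one for each child. *)
Fixpoint graft (T : tree) (s : seq tree) : tree :=
  match T with
  | Leaf => head Leaf s
  | Node l ts =>
      @Node l (fun i => graft (ts i)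
        (nth [::] (reshape [seq leaves (ts j) | j <- enum 'I_(rank l)] s) i))
  end.

(* Addresses are words in the child indices, which are counted from 0. *)
Fixpoint is_pos (T : tree) (a : seq nat) : bool :=
  match T, a with
  | _, [::] => true
  | Leaf, _ :: _ => false
  | Node l ts, p :: b => if insub p is Some i then is_pos (ts i) b else false
  end.

(* [subtree T a] is T|_a if [a] is a position of [T]. *)
Fixpoint subtree (T : tree) (a : seq nat) : tree :=
  match T, a with
  | _, [::] => T
  | Leaf, _ :: _ => Leaf
  | Node l ts, p :: b => if insub p is Some i then subtree (ts i) b else Leaf
  end.

(* [prunes X T]: [T] is obtainable from [X] by pruning. *)
Inductive prunes : tree -> tree -> Prop :=
| prunes_leaf X : prunes X Leaf
| prunes_node l (xs ts : 'I_(rank l) -> tree) :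
    (forall i, prunes (xs i) (ts i)) -> prunes (Node xs) (Node ts).

(* The longest prefix of [a] that is a position of [T]. *)
Fixpoint longest_prefix (T : tree) (a : seq nat) : seq nat :=
  match T, a with
  | _, [::] => [::]
  | Leaf, _ :: _ => [::]
  | Node l ts, p :: b =>
      if insub p is Some i then p :: longest_prefix (ts i) b else [::]
  end.

Lemma is_pos0 T : is_pos T [::].
Proof. by case: T. Qed.

Lemma subtree0 T : subtree T [::] = T.
Proof. by case: T. Qed.

Lemma longest_prefix0 T : longest_prefix T [::] = [::].
Proof. by case: T. Qed.

Lemma longest_prefix_leaf a : longest_prefix Leaf a = [::].
Proof. by case: a. Qed.

Lemma is_pos_longest_prefix T a : is_pos T (longest_prefix T a).
Proof.
elim: T a => [|l ts IH] [|p b] //=.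
by case Ep: (insub p : option 'I_(rank l)) => [i|] //=; rewrite Ep.
Qed.

Lemma longest_prefix_id T a : is_pos T a -> longest_prefix T a = a.
Proof.
elim: T a => [|l ts IH] [|p b] //=.
by case: (insub p : option 'I_(rank l)) => [i|] // /IH ->.
Qed.

Lemma is_pos_cat T a b : is_pos T a -> is_pos (subtree T a) b -> is_pos T (a ++ b).
Proof.
elim: T a => [|l ts IH] [|p a] //=.
by case: (insub p : option 'I_(rank l)) => [i|] //; apply: IH.
Qed.

Lemma subtree_cat T a b : is_pos T a ->
  subtree T (a ++ b) = subtree (subtree T a) b.
Proof.
elim: T a => [|l ts IH] [|p a] //=.
by case: (insub p : option 'I_(rank l)) => [i|] //; apply: IH.
Qed.

Lemma prunes_refl T : prunes T T.
Proof. by elim: T => [|l ts IH]; constructor. Qed.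

Lemma prunes_nodeE l xs T : prunes (@Node l xs) T ->
  T = Leaf \/ exists2 ts, T = @Node l ts & forall i, prunes (xs i) (ts i).
Proof.
move EX: (Node xs) => X H; case: H EX => [X0|l' xs' ts H] EX; first by left.
case: EX => El; subst l' => Ex; have {}Ex := inj_pair2 _ _ _ _ _ Ex.
by right; exists ts => // i; rewrite Ex.
Qed.

Lemma prunes_trans Y X Z : prunes X Y -> prunes Y Z -> prunes X Z.
Proof.
move=> H; elim: H Z => [X0|l xs ts _ IH] Z.
  by move EL: Leaf => Y' H; case: H EL => [*|//]; constructor.
case/prunes_nodeE => [->|[zs -> H]]; first by constructor.
by constructor=> i; apply: IH.
Qed.

Lemma prunes_subtree Y S a : prunes Y S -> is_pos Y a ->
  prunes (subtree Y a) (subtree S (longest_prefix S a)).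
Proof.
move=> H; elim: H a => [X|l xs ts Hxt IH] [|p b] //=; try by constructor.
by case Ep: (insub p : option 'I_(rank l)) => [i|] //=; rewrite Ep; apply: IH.
Qed.

Lemma longest_prefix_prunes Y S a : prunes Y S ->
  longest_prefix S (longest_prefix Y a) = longest_prefix S a.
Proof.
move=> H; elim: H a => [X|l xs ts _ IH] a; first by rewrite !longest_prefix_leaf.
case: a => [|p b] //=.
by case Ep: (insub p : option 'I_(rank l)) => [i|] //=; rewrite Ep IH.
Qed.

Lemma longest_prefix_cat Z S a b : prunes Z S -> is_pos Z b ->
  longest_prefix S (b ++ longest_prefix (subtree Z b) a) =
  longest_prefix S b ++ longest_prefix (subtree S (longest_prefix S b)) a.
Proof.
move=> H; elim: H b => [X|l xs ts Hxt IH] b.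
  by rewrite !longest_prefix_leaf.
case: b => [|p b].
- move=> _; rewrite !cat0s !longest_prefix0 !subtree0 (@longest_prefix_prunes (Node xs) (Node ts)) //.
  by constructor.
- by rewrite /=; case Ep: (insub p : option 'I_(rank l)) => [i|] //= /IH ->; rewrite Ep.
Qed.

(* A morphism X -> Y: an occurrence in [Y], given by its address, and the
   pruning map from [X] onto the subtree of [Y] at that address, which is
   unique if it exists. *)
Record tree_hom (X Y : tree) := TreeHom {
  address : seq nat;
  address_pos : is_pos Y address;
  tree_hom_prunes : prunes X (subtree Y address)
}.

Lemma tree_hom_inj X Y (f g : tree_hom X Y) : address f = address g -> f = g.
Proof.
case: f g => [a Ha Pa] [b Hb Pb] /= E; subst b.
by congr TreeHom; apply: Prop_irrelevance.
Qed.

Definition tree_id (X : tree) : tree_hom X X.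
Proof.
exists [::]; first exact: is_pos0.
by rewrite subtree0; apply: prunes_refl.
Defined.

Definition tree_cmp_address X Y Z (g : tree_hom Y Z) (f : tree_hom X Y) : seq nat :=
  address g ++ longest_prefix (subtree Z (address g)) (address f).

Lemma tree_cmp_pos X Y Z (g : tree_hom Y Z) (f : tree_hom X Y) :
  is_pos Z (tree_cmp_address g f).
Proof.
apply: is_pos_cat; first exact: address_pos.
exact: is_pos_longest_prefix.
Qed.

Lemma tree_cmp_prunes X Y Z (g : tree_hom Y Z) (f : tree_hom X Y) :
  prunes X (subtree Z (tree_cmp_address g f)).
Proof.
rewrite subtree_cat ?address_pos //.
apply: prunes_trans (tree_hom_prunes f) _.
by apply: prunes_subtree; [exact: tree_hom_prunes | exact: address_pos].
Qed.

Definition tree_cmp X Y Z (g : tree_hom Y Z) (f : tree_hom X Y) : tree_hom X Z :=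
  TreeHom (tree_cmp_pos g f) (tree_cmp_prunes g f).

Lemma tree_cmp1m X Y (f : tree_hom X Y) : tree_cmp (tree_id Y) f = f.
Proof.
apply: tree_hom_inj; rewrite /= /tree_cmp_address /= subtree0.
by rewrite longest_prefix_id // address_pos.
Qed.

Lemma tree_cmpm1 X Y (f : tree_hom X Y) : tree_cmp f (tree_id X) = f.
Proof.
apply: tree_hom_inj; rewrite /= /tree_cmp_address /=.
by rewrite longest_prefix0 cats0.
Qed.

Lemma tree_cmpA W X Y Z (f : tree_hom Y Z) (g : tree_hom X Y) (h : tree_hom W X) :
  tree_cmp f (tree_cmp g h) = tree_cmp (tree_cmp f g) h.
Proof.
apply: tree_hom_inj; rewrite /= /tree_cmp_address /= /tree_cmp_address.
rewrite longest_prefix_cat ?address_pos //; last exact: tree_hom_prunes.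
by rewrite -catA subtree_cat ?address_pos.
Qed.

Definition tree_category : category :=
  Category tree_cmp1m tree_cmpm1 tree_cmpA.



Lemma map_nth_enum (S T : Type) (f : S -> T) x (s : seq S) n :
  size s = n -> [seq f (nth x s i) | i : 'I_n <- enum 'I_n] = map f s.
Proof.
move=> <-; rewrite (map_comp (fun k => f (nth x s k)) val) val_enum_ord.
by rewrite (map_comp f (nth x s)) -/(mkseq _ _) mkseq_nth.
Qed.

Lemma nth_map_enum n (f : 'I_n -> nat) (i : 'I_n) :
  nth 0 [seq f j | j <- enum 'I_n] i = f i.
Proof. by rewrite (nth_map i) ?size_enum_ord // nth_ord_enum. Qed.

Lemma size_nth_reshape (T : Type) n (f : 'I_n -> nat) (s : seq T) (i : 'I_n) :
  size s = sumn [seq f j | j <- enum 'I_n] ->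
  size (nth [::] (reshape [seq f j | j <- enum 'I_n] s) i) = f i.
Proof.
move=> Hs; rewrite -[RHS]nth_map_enum.
rewrite -[in RHS](@reshapeKl _ [seq f j | j <- enum 'I_n] s) ?Hs //.
by rewrite (nth_map [::]) // size_reshape size_map size_enum_ord.
Qed.

Lemma take_zip (S T : Type) (s : seq S) (t : seq T) n :
  take n (zip s t) = zip (take n s) (take n t).
Proof. by elim: s t n => [|x s IH] [|y t] [|n] //=; rewrite ?IH //; case: take. Qed.

Lemma drop_zip (S T : Type) (s : seq S) (t : seq T) n :
  drop n (zip s t) = zip (drop n s) (drop n t).
Proof. by elim: s t n => [|x s IH] [|y t] [|n] //=; rewrite ?IH //; case: drop. Qed.

Lemma flatten_flatten (T : Type) (s : seq (seq (seq T))) :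
  flatten (map flatten s) = flatten (flatten s).
Proof. by elim: s => //= x s ->; rewrite flatten_cat. Qed.

Lemma leaves_graft T s : size s = leaves T ->
  leaves (graft T s) = sumn [seq leaves t | t <- s].
Proof.
elim: T s => [|l ts IH] s /= Hs.
  by case: s Hs => [|x [|y s]] //= _; rewrite addn0.
set sh := map _ _ in Hs *.
transitivity (sumn [seq sumn (map leaves (nth [::] (reshape sh s) i))
                   | i : 'I_(rank l) <- enum 'I_(rank l)]).
  congr sumn; apply: eq_map => i; apply: IH.
  exact: size_nth_reshape.
rewrite (map_nth_enum (fun u => sumn (map leaves u))); last first.
  by rewrite size_reshape size_map size_enum_ord.
by rewrite (map_comp sumn (map leaves)) -sumn_flatten -map_flatten reshapeKr ?Hs.
Qed.

Lemma graft_leaf s : graft Leaf [:: s] = s.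
Proof. by []. Qed.

Lemma graft_leaves T : graft T (nseq (leaves T) Leaf) = T.
Proof.
elim: T => [|l ts IH] //=; congr Node; apply/funext => i.
rewrite -[RHS]IH; congr graft; rewrite nth_reshape drop_nseq nth_map_enum.
rewrite take_nseq //; set sh := map _ _.
rewrite -[in sumn sh](cat_take_drop i sh) sumn_cat addKn.
rewrite (drop_nth 0) /= ?nth_map_enum ?leq_addr //.
by rewrite size_map size_enum_ord.
Qed.

Lemma graftA T ys zss : size ys = leaves T -> shape zss = [seq leaves y | y <- ys] ->
  graft (graft T ys) (flatten zss) = graft T [seq graft p.1 p.2 | p <- zip ys zss].
Proof.
elim: T ys zss => [|l ts IH] ys zss /= Hys Hz.
  case: ys Hys Hz => [|y [|y' ys]] // _.
  by case: zss => [|z [|z' zss]] //= _; rewrite cats0.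
have Hzs : size zss = size ys by rewrite -(size_map size zss) -/(shape _) Hz size_map.
congr Node; apply/funext => i; set sh := map _ _ in Hys *.
set B := reshape sh ys; set Z := reshape sh zss.
have size_sh : size sh = rank l by rewrite size_map size_enum_ord.
have EB : [seq leaves (graft (ts j) (nth [::] B j)) | j <- enum 'I_(rank l)]
          = shape (map flatten Z).
  transitivity [seq sumn (map leaves (nth [::] B j)) | j : 'I_(rank l) <- enum 'I_(rank l)].
    by apply: eq_map => j; rewrite leaves_graft // size_nth_reshape.
  rewrite (map_nth_enum (fun u => sumn (map leaves u))) ?size_reshape //.
  rewrite (map_comp sumn (map leaves)) map_reshape -Hz /shape -map_reshape -/Z.
  by rewrite -!map_comp; apply: eq_map => u /=; rewrite size_flatten.
have EZ : flatten zss = flatten (map flatten Z).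
  by rewrite flatten_flatten reshapeKr // Hzs Hys.
rewrite EB EZ flattenK (nth_map [::]) ?size_reshape ?size_sh //.
rewrite IH; [|exact: size_nth_reshape|]; last first.
  rewrite /shape -[LHS](nth_map _ [::] (map size)) ?size_reshape ?size_sh //.
  rewrite -[RHS](nth_map _ [::] (map leaves)) ?size_reshape ?size_sh //.
  by rewrite !map_reshape -/(shape _) Hz.
rewrite -map_reshape (nth_map [::]) ?size_reshape ?size_sh //.
by rewrite !nth_reshape drop_zip take_zip.
Qed.

Definition tree_operad : operad tree :=
  Operad (arity := leaves) (ounit := Leaf) (ocomp := graft) erefl
    leaves_graft graft_leaf graft_leaves graftA.

End Trees.

(** * The prefix-suffix matching category of a free operad *)

Section Matching.
Variables (D : category) (T : Type) (t : T -> D).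

Definition full_category : category :=
  @Category T (fun x y => hom (t x) (t y)) (fun x => idm (t x))
    (fun x y z g f => g ∘ f)
    (fun x y f => cmp1m f) (fun x y f => cmpm1 f)
    (fun w x y z f g h => cmpA f g h).

End Matching.

(* [C] is isomorphic to the prefix-suffix matching category of the operations
   of the operad [O], free on [iota : L -> T]: the operations are identified
   with trees over [L] by the isomorphism [t] of free operads extending
   [l |-> corolla l], and morphisms of operations are the morphisms of the
   corresponding trees. *)
Definition is_matching_category (C : category) (L : ranked_set) (T : Type)
    (O : operad T) (iota : L -> T) : Prop :=
  exists t : T -> tree_category L,
    [/\ operad_iso O (tree_operad L) t,
        (forall l, t (iota l) = corolla l) &
        cat_isomorphic C (full_category t)].

(** * The operad of a category *)

(* The number of elements of a finite set. *)
Definition card (T : Type) (A : set T) : nat := xget 0 [set n | A #= `I_n].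

Definition derived_ranked_set (C : category) (one : C) : ranked_set :=
  @RankedSet {phi : C | is_letter one phi} (fun phi => card (@Comp C (sval phi))).

Definition letter_object (C : category) (one : C) :
  derived_ranked_set one -> C := fun phi => sval phi.

Section FillingOperad.
Variables (C : category) (one : C) (q : forall X : C, hom X one).
Variable R : forall phi : C, arrow_into phi -> arrow_into phi -> Prop.

Record is_filling_operad (O : operad C) : Prop := IsFillingOperad {
  filling_arity : forall (X : C) (n : nat),
    arity O X = n <-> [set: hom one X] #= `I_n;
  filling_ounit : ounit O = one;
  filling_inputs : forall X : C, exists js : seq (hom one X), inputs R js;
  filling_ocomp : forall (X : C) (n : nat) (js : n.-tuple (hom one X))
      (As : n.-tuple C), inputs R js ->
    exists (d : hom (ocomp O X As) X)
           (u : forall i : 'I_n, hom (tnth As i) (ocomp O X As)),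
      universal_filling q (tnth js) d u /\
      forall ks : forall i : 'I_n, seq (hom one (tnth As i)),
        (forall i, inputs R (ks i)) ->
        inputs R (flatten [seq [seq u i ∘ k | k <- ks i] | i <- enum 'I_n])
}.

End FillingOperad.

(* Main.v *)
(* Under the axioms the strong subobjects of X form a finite tree (A7,
   A8), and an epimorphism d : X -> Y with Y <> 1 induces a bijection between the
   indecomposable subobjects ("components") of X and of Y: an epimorphism
   d o i with i proper would produce a retraction of a proper strong
   monomorphism, which A8 and A9 forbid.  By A9, d is an identity as soon as all
   its restrictions to components are.  Pushing out one component at a time
   along an epimorphism (A4) leaves the other components alone (A5), so maps can
   be collapsed and compared by induction over the components: this gives the
   unique reduction X -> r(X) = phi, uniqueness of epimorphisms, and, with the
   terminal fillings of A6, a unique object phi(X_1, ..., X_n) with prescribed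
   components.  Hence objects are trees over Phi, strong monomorphisms are
   positions, epimorphisms are prunings, and C is the expression tree category;
   the operad is the tree operad transported along this bijection.  A filling
   of all the leaves of a tree can only be the grafted tree, which makes grafting
   the universal filling. *)

Require Import Defs.
From Stdlib Require Import List Sorting.Sorted Eqdep.
From mathcomp Require Import all_boot.
From mathcomp Require Import boolp classical_sets cardinality.

Set Implicit Arguments.
Unset Strict Implicit.
Unset Printing Implicit Defensive.

Local Open Scope classical_set_scope.

(** * Sorted lists *)

(** The axioms provide pushouts and fillings at one strong monomorphism at a time, and A5 controls
    the rest of the object only for epimorphisms with at most one nontrivial fibre, such as the
    collapse of a component to [one]. This gives the inductions over components their common shape:
    a list of indices is kept such that the claim is already trivial at every index outside it, and
    one pushout or filling disposes of the head without disturbing the other components. Since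
    isomorphisms are identities, whatever is unique up to isomorphism is unique on the nose. The
    resulting equalities of objects are only propositional, however, so arrows with provably equal
    sources are compared as elements of [arrow_into], and the correspondence between morphisms is
    first set up as a relation. *)

Section SortedLists.
Variable T : Type.
Implicit Types (R : T -> T -> Prop) (s : seq T).

Lemma In_nth x0 s i : i < size s -> List.In (nth x0 s i) s.
Proof. by elim: s i => [|x s IH] [|i] //= lt; [left|right; apply: IH]. Qed.

Lemma nth_In x0 s x : List.In x s -> exists2 i, i < size s & nth x0 s i = x.
Proof.
elim: s => //= y s IH [->|/IH[i lt <-]]; first by exists 0.
by exists i.+1.
Qed.

Lemma NoDup_nth_inj x0 s i j : List.NoDup s -> i < size s -> j < size s ->
  nth x0 s i = nth x0 s j -> i = j.
Proof.
move=> H; elim: H i j => // x s1 nx _ IH [|i] [|j] //= lti ltj E.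
- by case: nx; rewrite E; apply: In_nth.
- by case: nx; rewrite -E; apply: In_nth.
- by rewrite (IH i j).
Qed.

Lemma StronglySorted_cat R s1 s2 : StronglySorted R s1 -> StronglySorted R s2 ->
  (forall x y, List.In x s1 -> List.In y s2 -> R x y) -> StronglySorted R (s1 ++ s2).
Proof.
move=> H1 H2; elim: H1 => //= x s sS IH xs H.
constructor; first by apply: IH => y z ys zs; apply: H => //; right.
apply/Forall_forall => y /in_app_iff[ys|ys].
  by move/Forall_forall: xs; apply.
by apply: H => //; left.
Qed.

Lemma StronglySorted_flatten R n (F : 'I_n -> seq T) :
  (forall i, StronglySorted R (F i)) ->
  (forall (i j : 'I_n) x y, i < j -> List.In x (F i) -> List.In y (F j) -> R x y) ->
  StronglySorted R (flatten [seq F i | i <- enum 'I_n]).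
Proof.
move=> HF Hlt.
have : pairwise (fun i j : 'I_n => i < j) (enum 'I_n).
  rewrite -(pairwise_map val ltn) val_enum_ord -sorted_pairwise ?iota_ltn_sorted //.
  exact: ltn_trans.
elim: (enum _) => [|i l IH] /=; first by constructor.
case/andP => il /IH Hl; apply: StronglySorted_cat => // x y xi.
have : forall j, j \in l -> i < j by move/allP: il.
elim: l {IH il Hl} => //= j l IH Hj /in_app_iff[yj|yl].
  by apply: (Hlt i j) => //; apply: Hj; rewrite inE eqxx.
by apply: IH => // k kl; apply: Hj; rewrite inE kl orbT.
Qed.

Lemma StronglySorted_NoDup R s :
  (forall x, ~ R x x) -> StronglySorted R s -> List.NoDup s.
Proof.
move=> irr; elim=> [|x s1 _ IH /Forall_forall xs]; constructor=> //.
by move/xs/irr.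
Qed.

Lemma StronglySorted_unique R s s' :
  (forall x y, R x y -> R y x -> False) -> StronglySorted R s -> StronglySorted R s' ->
  (forall x, List.In x s <-> List.In x s') -> s = s'.
Proof.
move=> asym H; elim: H s' => [|x s1 sS IH /Forall_forall xs] [|y s2] H' E.
- by [].
- by have /E := or_introl erefl : List.In y (y :: s2).
- by have /E := or_introl erefl : List.In x (x :: s1).
have [sS' /Forall_forall ys] := StronglySorted_inv H'.
have Exy : x = y.
  have /E[->//|/ys yx] := or_introl erefl : List.In x (x :: s1).
  by have /E[->//|/xs /asym/(_ yx)] := or_introl erefl : List.In y (y :: s2).
subst y; rewrite (IH s2) // => z; split=> zs.
  have /E[xz|//] := or_intror zs : List.In z (x :: s1).
  by subst z; case: (asym _ _ (xs _ zs) (xs _ zs)).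
have /E[xz|//] := or_intror zs : List.In z (x :: s2).
by subst z; case: (asym _ _ (ys _ zs) (ys _ zs)).
Qed.

Lemma StronglySorted_map U (f : T -> U) (R : U -> U -> Prop) s :
  StronglySorted R [seq f x | x <- s] -> StronglySorted (fun x y => R (f x) (f y)) s.
Proof.
elim: s => /= [|x s IH] H; first by constructor.
have [sS xs] := StronglySorted_inv H; constructor; first exact: IH.
by elim: s xs {IH sS H} => //= y s IH H; inversion H; constructor => //; apply: IH.
Qed.

Lemma zip_nth_enum U x0 y0 (s : seq T) (r : seq U) n : size s = n -> size r = n ->
  zip s r = [seq (nth x0 s i, nth y0 r i) | i : 'I_n <- enum 'I_n].
Proof.
move=> ss sr; rewrite -[LHS](mkseq_nth (x0, y0)) size_zip ss sr minnn /mkseq.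
rewrite -val_enum_ord -map_comp; apply: eq_map => i /=.
by rewrite nth_zip // ss sr.
Qed.

End SortedLists.

(** * Identities, factorizations and pullbacks *)

Section Identities.
Variable C : category.
Implicit Types X Y Z A B W : C.

Lemma is_id_eq X (f : hom X X) : is_id f -> f = idm X.
Proof.
move=> H.
(* [is_id] is indexed by the target and cannot be destructed when source and target coincide. Hence
   the generalization over an equality of objects, whose transport vanishes by proof irrelevance. *)
suff G : forall Y (g : hom X Y), is_id g ->
    forall E : Y = X, eq_rect Y (hom X) g X E = idm X.
  exact: (G _ _ H erefl).
by move=> Y g [] E; rewrite (Prop_irrelevance E erefl).
Qed.

Lemma is_id_cancel X Y (f : hom X Y) : is_id f ->
  exists2 g : hom Y X, is_id g & g ∘ f = idm X /\ f ∘ g = idm Y.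
Proof. by case; exists (idm X); [|rewrite cmp1m]. Qed.

Lemma is_id_cmp X Y Z (g : hom Y Z) (f : hom X Y) :
  is_id f -> is_id g -> is_id (g ∘ f).
Proof. by move=> Hf; case: Hf g => X0 g; rewrite cmpm1. Qed.

Lemma is_id_ob X Y (f : hom X Y) : is_id f -> X = Y.
Proof. by case. Qed.

Lemma is_id_src X (i : arrow_into X) : is_id (arr i) -> i = id_arrow_into X.
Proof. by case: i => A f /= []. Qed.

Lemma arrow_into_eta X (i : arrow_into X) : ArrowInto (arr i) = i.
Proof. by case: i. Qed.

Lemma arrow_into_cmp_id X (k : arrow_into X) A (h : hom A (src k)) :
  is_id h -> ArrowInto (arr k ∘ h) = k.
Proof. by case: k h => B k /= h H; case: H k => k; rewrite cmpm1. Qed.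

Lemma arrow_into_inj X A (f g : hom A X) : ArrowInto f = ArrowInto g -> f = g.
Proof. by case=> /(inj_pair2 _ _ _ _ _). Qed.

Lemma arrow_into_src X (i : arrow_into X) A : src i = A ->
  exists f : hom A X, ArrowInto f = i.
Proof. by case: i => B f /= <-; exists f. Qed.

Lemma idm_iso X : is_iso (idm X).
Proof. by exists (idm X); rewrite cmp1m. Qed.

Lemma is_id_iso X Y (f : hom X Y) : is_id f -> is_iso f.
Proof. by case; apply: idm_iso. Qed.

Lemma iso_cmp X Y Z (g : hom Y Z) (f : hom X Y) :
  is_iso g -> is_iso f -> is_iso (g ∘ f).
Proof.
move=> [g' [g1 g2]] [f' [f1 f2]]; exists (f' ∘ g'); split.
  by rewrite cmpA -(cmpA f') g1 cmpm1.
by rewrite cmpA -(cmpA g) f2 cmpm1.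
Qed.

Lemma iso_epi X Y (f : hom X Y) : is_iso f -> epi f.
Proof. by move=> [f' [_ f2]] Z g h /(congr1 (cmp^~ f')); rewrite -!cmpA f2 !cmpm1. Qed.

Lemma epi_cmp X Y Z (g : hom Y Z) (f : hom X Y) : epi g -> epi f -> epi (g ∘ f).
Proof. by move=> eg ef W a b; rewrite !cmpA => /ef /eg. Qed.

Lemma epi_cancel X Y Z (g : hom Y Z) (f : hom X Y) : epi (g ∘ f) -> epi g.
Proof. by move=> e W a b E; apply: e; rewrite !cmpA E. Qed.

Lemma split_mono_strong X Y (m : hom X Y) (r : hom Y X) :
  r ∘ m = idm X -> strong_mono m.
Proof.
move=> rm; split=> [Z g h /(congr1 (cmp r))|]; first by rewrite !cmpA rm !cmp1m.
move=> P Q e ee a b E; exists (r ∘ b).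
have Ea : (r ∘ b) ∘ e = a by rewrite -cmpA -E cmpA rm cmp1m.
by split=> //; apply: ee; rewrite -cmpA Ea.
Qed.

Lemma iso_strong X Y (m : hom X Y) : is_iso m -> strong_mono m.
Proof. by move=> [r [rm _]]; apply: split_mono_strong rm. Qed.

Lemma strong_cmp X Y Z (g : hom Y Z) (f : hom X Y) :
  strong_mono g -> strong_mono f -> strong_mono (g ∘ f).
Proof.
move=> [mg sg] [mf sf]; split=> [W a b|P Q e ee a b].
  by rewrite -!cmpA => /mg /mf.
rewrite -cmpA => /(sg _ _ _ ee) [l [le gl]].
have [k [ke fk]] := sf _ _ _ ee _ _ (esym le).
by exists k; split=> //; rewrite -cmpA fk.
Qed.

Lemma strong_cancel X Y Z (g : hom Y Z) (f : hom X Y) :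
  strong_mono (g ∘ f) -> strong_mono f.
Proof.
move=> [m s]; split=> [W a b E|P Q e ee a b E].
  by apply: m; rewrite -!cmpA E.
have [|l [le ml]] := s _ _ _ ee a (g ∘ b); first by rewrite -!cmpA E.
exists l; split=> //; apply: ee.
by rewrite -cmpA le.
Qed.

Lemma epi_strong_iso X Y (f : hom X Y) : epi f -> strong_mono f -> is_iso f.
Proof.
move=> ef [_ s]; have [|l [lf fl]] := s _ _ _ ef (idm X) (idm Y).
  by rewrite cmpm1 cmp1m.
by exists l.
Qed.

Lemma epi_split_iso X Y (f : hom X Y) (r : hom Y X) :
  epi f -> r ∘ f = idm X -> is_iso f.
Proof. by move=> ef /split_mono_strong /(epi_strong_iso ef). Qed.

Lemma mono_split_iso X Y (f : hom X Y) (r : hom Y X) :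
  mono f -> f ∘ r = idm Y -> is_iso f.
Proof. by move=> mf E; exists r; split=> //; apply: mf; rewrite cmpA E cmpm1 cmp1m. Qed.

Lemma pullback_strong X Y Z (f : hom X Z) (g : hom Y Z) P (p : hom P X) (r : hom P Y) :
  is_pullback f g p r -> strong_mono g -> strong_mono p.
Proof.
move=> [E U] [mg sg]; split.
  move=> W a b Eab.
  have Erab : r ∘ a = r ∘ b by apply: mg; rewrite !cmpA -E -!cmpA Eab.
  have [|h [_ Uh]] := U W (p ∘ a) (r ∘ a); first by rewrite !cmpA E.
  by rewrite -(Uh a) // -(Uh b).
move=> Q T e ee a b Eab.
have [|l [le gl]] := sg _ _ _ ee (r ∘ a) (f ∘ b).
  by rewrite cmpA -E -!cmpA Eab.
have [h [[ph rh] _]] := U T b l (esym gl).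
exists h; split=> //.
have [|k [_ Uk]] := U Q (p ∘ a) (r ∘ a); first by rewrite !cmpA E.
rewrite -(Uk (h ∘ e)) ?(Uk a) //; split; first by rewrite cmpA ph Eab.
by rewrite cmpA rh le.
Qed.

(* Uniqueness of the mediating morphism is automatic along a monomorphism. *)
Lemma is_pullback_mono X Y Z (f : hom X Z) (g : hom Y Z) P (p : hom P X) (r : hom P Y) :
  mono p -> mono g -> f ∘ p = g ∘ r ->
  (forall W (a : hom W X) (b : hom W Y), f ∘ a = g ∘ b -> exists h, p ∘ h = a) ->
  is_pullback f g p r.
Proof.
move=> mp mg E H; split=> // W a b Eab; have [h ph] := H _ _ _ Eab.
exists h; split=> [|k [pk _]]; last by apply: mp; rewrite ph.
by split=> //; apply: mg; rewrite cmpA -E -cmpA ph.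
Qed.

Lemma pullback_iso_comparison X Y Z (f : hom X Z) (g : hom Y Z)
    P (p : hom P X) (r : hom P Y) P' (p' : hom P' X) (r' : hom P' Y) :
  is_pullback f g p r -> is_pullback f g p' r' ->
  exists2 h : hom P' P, is_iso h & p ∘ h = p' /\ r ∘ h = r'.
Proof.
move=> [E U] [E' U']; have [h [[ph rh] _]] := U _ _ _ E'.
have [k [[pk rk] _]] := U' _ _ _ E.
exists h => //; exists k; split.
  have [x [_ Ux]] := U' _ _ _ E'.
  by rewrite -(Ux (k ∘ h)) ?(Ux (idm _)) ?cmpA ?pk ?rk ?cmpm1.
have [x [_ Ux]] := U _ _ _ E.
by rewrite -(Ux (h ∘ k)) ?(Ux (idm _)) ?cmpA ?ph ?rh ?cmpm1.
Qed.

Lemma pullback_iso X Y Z (f : hom X Z) (g : hom Y Z) P (p : hom P X) (r : hom P Y) :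
  is_pullback f g p r -> mono p -> is_iso g -> is_iso p.
Proof.
move=> [E U] mp [g' [g'g gg']].
have [|y [[py _] _]] := U X (idm X) (g' ∘ f); first by rewrite cmpm1 cmpA gg' cmp1m.
exact: mono_split_iso py.
Qed.

Lemma factorization_unique X Y M (e : hom X M) (m : hom M Y)
    M' (e' : hom X M') (m' : hom M' Y) :
  epi e -> strong_mono m -> epi e' -> strong_mono m' -> m ∘ e = m' ∘ e' ->
  exists2 h : hom M M', is_iso h & m' ∘ h = m /\ h ∘ e = e'.
Proof.
move=> ee [mm sm] ee' [mm' sm'] E.
have [h [he m'h]] := sm' _ _ _ ee _ _ (esym E).
have [k [ke' mk]] := sm _ _ _ ee' _ _ E.
exists h => //; exists k; split.
  by apply: mm; rewrite cmpA mk m'h cmpm1.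
by apply: mm'; rewrite cmpA m'h mk cmpm1.
Qed.

Lemma pushout_epi X Y Z (u : hom Z X) (a : hom Z Y) P (c : hom X P) (v : hom Y P) :
  is_pushout u a c v -> epi a -> epi c.
Proof.
move=> [E U] ea W g h Egh.
have Ev : g ∘ v = h ∘ v by apply: ea; rewrite -!cmpA -E !cmpA Egh.
have [|k [_ Uk]] := U W (g ∘ c) (g ∘ v); first by rewrite -!cmpA E.
by rewrite -(Uk g) // -(Uk h).
Qed.

End Identities.

(** * Components *)

Definition enumerates (T : Type) (A : set T) n (u : 'I_n -> T) : Prop :=
  injective u /\ forall x, A x <-> exists p, u p = x.

Lemma card_eq_enumerates T (A : set T) n : (A #= `I_n)%card ->
  exists u : 'I_n -> T, enumerates A u.
Proof.
case/card_set_bijP => f [fI finj fsurj].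
have /choice[u Hu] : forall p : 'I_n, exists x, A x /\ f x = p.
  by move=> p; have [|x Ax fx] := fsurj p; [exact: ltn_ord|exists x].
exists u; split=> [p r E|x]; first by apply/val_inj; rewrite /= -(Hu p).2 E (Hu r).2.
split=> [Ax|[p <-]]; last exact: (Hu p).1.
have fx : f x < n by apply: fI.
exists (Ordinal fx); apply: finj; rewrite ?inE //; first exact: (Hu _).1.
by rewrite (Hu _).2.
Qed.

Lemma enumerates_card_eq T (A : set T) n (u : 'I_n -> T) : enumerates A u ->
  (A #= `I_n)%card.
Proof.
move=> [inj surj]; suff -> : A = u @` [set: 'I_n].
  apply: card_eq_trans (card_esym card_II).
  by apply: inj_card_eq => x y _ _ /inj.
apply/seteqP; split=> x; first by case/surj => p <-; exists p.
by case=> p _ <-; apply/surj; exists p.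
Qed.

Lemma card_unique T (A : set T) n : (A #= `I_n)%card -> Defs.card A = n.
Proof.
move=> An; rewrite /Defs.card; case: xgetP => [m _|/(_ n)] //.
by rewrite /= (card_eql An) => /card_eq_II.
Qed.

Lemma finite_set_card T (A : set T) : finite_set A -> (A #= `I_(Defs.card A))%card.
Proof. by case/finite_setP => n An; rewrite (card_unique An). Qed.

Section Components.
Variables (C : category) (one : C) (q : forall X : C, hom X one).
Hypothesis axC : nine_axioms q.
Implicit Types X Y Z A B W : C.

Lemma to_one X (f g : hom X one) : f = g.
Proof. by rewrite (A1 axC f) (A1 axC g). Qed.

Lemma point_strong X (j : hom one X) : strong_mono j.
Proof. by apply: (@split_mono_strong _ _ _ _ (q X)); apply: to_one. Qed.

(** The fibre of an isomorphism over any point j is the point [g ∘ j], with g the inverse, so A9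
    applies. From here on isomorphic objects are equal. *)
Lemma iso_is_id X Y (f : hom X Y) : is_iso f -> is_id f.
Proof.
move=> isof; have [g [gf fg]] := isof; apply: (A9 axC); first exact: iso_epi.
move=> j; exists one, (g ∘ j), (idm one); split; last exact: idm_iso.
apply: is_pullback_mono.
- by case: (point_strong (g ∘ j)).
- by case: (point_strong j).
- by rewrite cmpA fg cmp1m cmpm1.
- by move=> W a b E; exists b; rewrite -cmpA -E cmpA gf cmp1m.
Qed.

Lemma epi_strong_id X Y (f : hom X Y) : epi f -> strong_mono f -> is_id f.
Proof. by move=> ef sf; apply: iso_is_id; apply: epi_strong_iso. Qed.

(* A filling of A at the point of 1 is an isomorphic copy of A, so the mere
   existence of one makes q_A an epimorphism. *)
Lemma q_epi A : epi (q A).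
Proof.
have [D [d [u [[ed /(_ tt)[su [E U]]] _]]]] := A6 axC A (idm one).
have [|h [[uh _] _]] := U _ (idm D) d; first by rewrite cmpm1 cmp1m.
have isou : is_iso u by apply: mono_split_iso uh; case: su.
by rewrite (to_one (q A) (d ∘ u)); apply: epi_cmp => //; apply: iso_epi.
Qed.

Lemma strong_to_one A (f : hom A one) : strong_mono f -> is_id f.
Proof. by apply: epi_strong_id; rewrite (A1 axC f); apply: q_epi. Qed.

Lemma epi_from_one Y (d : hom one Y) : epi d -> is_id d.
Proof. by move/epi_strong_id; apply; apply: point_strong. Qed.

Lemma epi_src_neq_one X Y (d : hom X Y) : epi d -> Y <> one -> X <> one.
Proof. by move=> ed Y1 X1; subst X; apply: Y1; case: (epi_from_one ed). Qed.

Lemma strong_src_one A X (i : hom A X) : A = one -> strong_mono i.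
Proof. by move=> E; subst A; apply: point_strong. Qed.

(** By A9 it suffices that each fibre P of h is a point. Over w, both P and Y contain the point
    [v ∘ w] of Z, so A8 compares them. If P lies in Y, applying h shows that P is just that point;
    if Y lies in P, the identity [h ∘ v] factors through w, which forces Y to be [one]. *)
Lemma retraction_of_strong_id Z Y (v : hom Y Z) (h : hom Z Y) :
  strong_mono v -> h ∘ v = idm Y -> Y <> one -> is_id h.
Proof.
move=> sv hv Y1.
have eh : epi h by apply: (@epi_cancel _ _ _ _ _ v); rewrite hv; apply/iso_epi/idm_iso.
apply: (A9 axC) => // w.
have [P [p [r [pb _]]]] := A3 axC eh (point_strong w).
exists P, p, r; split=> //.
have sp := pullback_strong pb (point_strong w).
have [E U] := pb.
have [|x [[px rx] _]] := U _ (v ∘ w) (idm one); first by rewrite cmpA hv cmp1m cmpm1.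
have [[f [fx vf]]|[k [kw pk]]] := A8 axC (point_strong x) (point_strong w) sp sv px.
  exists x; split; last exact: to_one.
  case: sp => mp _; apply: mp; rewrite cmpA px cmpm1 -vf -cmpA; congr (_ ∘ _).
  by rewrite -[LHS]/(w ∘ r) -E -vf cmpA hv cmp1m.
case: Y1; have : is_id w; last by case.
apply: iso_is_id; apply: (@mono_split_iso _ _ _ _ (r ∘ k)).
  by case: (point_strong w).
by rewrite cmpA -E -cmpA pk hv.
Qed.

(* If d i were an epimorphism, pushing i out along it would give a nonidentity
   strong monomorphism with a retraction. *)
Lemma epi_restriction_id X Y (d : hom X Y) A (i : hom A X) :
  epi d -> Y <> one -> strong_mono i -> epi (d ∘ i) -> is_id i.
Proof.
move=> ed Y1 si edi.
have [Z [c [v [[cv U] sv pb]]]] := A4 axC si edi.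
have [|h [[hc hv] _]] := U Y d (idm Y); first by rewrite cmp1m.
have idh := retraction_of_strong_id sv hv Y1.
have isov : is_iso v.
  have [g _ [gh hg]] := is_id_cancel idh.
  have -> : v = g by rewrite -[v]cmp1m -gh -cmpA hv cmpm1.
  by exists h.
by apply: iso_is_id; apply: (pullback_iso pb) isov; case: si.
Qed.

Lemma extend_inj X (i : arrow_into X) (w w' : arrow_into (src i)) :
  strong_mono (arr i) -> extend w = extend w' -> w = w'.
Proof.
case: i w w' => A i [B f] [B' f'] /= [mi _]; rewrite /extend /= => -[E].
by subst B' => /(inj_pair2 _ _ _ _ _) /mi ->.
Qed.

(* The measure m X is the size of S(X). *)
Lemma strong_measure : exists m : C -> nat, forall A X (i : hom A X),
  strong_mono i -> ~ is_id i -> m A < m X.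
Proof.
have /choice[m Hm] : forall X, exists n, exists u : 'I_n -> _, enumerates (@S_ C X) u.
  move=> X; have [/finite_setP[n Hn] _] := A7 axC X.
  by exists n; apply: card_eq_enumerates.
exists m => A X i si ni; have [u [uinj uE]] := Hm A; have [v [vinj vE]] := Hm X.
have Su p : strong_mono (arr (u p)) by apply/uE; exists p.
(* [Some] embeds S(A) into S(X) by composition with i, and [None] goes to the identity of X, which
   is missed because i is proper. So S(X) has at least one element more. *)
have /choice[f Hf] : forall o : option 'I_(m A), exists r, v r =
    if o is Some p then ArrowInto (i ∘ arr (u p)) else id_arrow_into X.
  case=> [p|]; apply/vE; rewrite /S_ /=; last exact/iso_strong/idm_iso.
  exact: strong_cmp.
have finj : injective f.
  have H p : id_arrow_into X <> ArrowInto (i ∘ arr (u p)).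
    move=> E; apply: ni; apply: iso_is_id; apply: epi_strong_iso => //.
    apply: (@epi_cancel _ _ _ _ _ (arr (u p))).
    have : epi (arr (id_arrow_into X)) by apply/iso_epi/idm_iso.
    by rewrite E.
  move=> [p|] [p'|] // /(congr1 v); rewrite !Hf; last 2 first.
  - by move/esym/H.
  - by move/H.
  by move/(@extend_inj X (ArrowInto i) (u p) (u p') si)/uinj => ->.
by have := leq_card _ finj; rewrite card_option !card_ord.
Qed.

Lemma comp_strong X (i : arrow_into X) : Comp i -> strong_mono (arr i).
Proof. by case. Qed.

Lemma comp_nid X (i : arrow_into X) : Comp i -> ~ is_id (arr i).
Proof. by case. Qed.

Lemma comp_neq_one X (i : arrow_into X) : Comp i -> X <> one.
Proof. by case=> s n _ E; subst X; apply: n; apply: strong_to_one. Qed.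

(** If i = v u with both parts proper, then v is strictly closer to X in the measure, so the
    induction on [m X - m A] ends at an indecomposable arrow. *)
Lemma exists_comp X A (i : hom A X) : strong_mono i -> ~ is_id i ->
  exists2 k : arrow_into X, Comp k &
    exists2 w : hom A (src k), strong_mono w & arr k ∘ w = i.
Proof.
have [m Hm] := strong_measure.
elim: {A}(m X - m A) {-2}A (leqnn (m X - m A)) i => [|n IH] A le i si ni.
  by have := Hm _ _ _ si ni; rewrite -subn_gt0 ltnNge le.
case: (pselect (indecomposable i)) => [ind|nind].
  by exists (ArrowInto i) => //; exists (idm A); rewrite ?cmpm1 //; apply/iso_strong/idm_iso.
have [B [u [v [su sv Ei nu nv]]]] : exists B (u : hom A B) (v : hom B X),
    [/\ strong_mono u, strong_mono v, i = v ∘ u, ~ is_id u & ~ is_id v].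
  apply: contrapT => H; apply: nind; split=> // B u v su sv Ei.
  by apply: contrapT => /not_orP[nu nv]; apply: H; exists B, u, v.
have ltm := Hm _ _ _ su nu; have ltm' := Hm _ _ _ sv nv.
have [|k kc [w sw kw]] := IH B _ v sv nv.
  by rewrite -ltnS (leq_trans _ le) // ltn_sub2l // (ltn_trans ltm).
exists k => //; exists (w ∘ u); first exact: strong_cmp.
by rewrite cmpA kw.
Qed.

Lemma comp_factor X (i k : arrow_into X) (h : hom (src i) (src k)) :
  Comp i -> Comp k -> arr k ∘ h = arr i -> i = k.
Proof.
case: i k h => A i [B k] /= h [si ni ind] [sk nk _] E.
have sh : strong_mono h by apply: (@strong_cancel _ _ _ _ k); rewrite E.
have [idh|//] := ind _ _ _ sh sk (esym E).
by case: idh k {sh sk nk} E => k; rewrite cmpm1 => ->.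
Qed.

Lemma comp_disjoint X (i k : arrow_into X) A (w : hom A (src i)) (w' : hom A (src k)) :
  Comp i -> Comp k -> strong_mono w -> strong_mono w' ->
  arr i ∘ w = arr k ∘ w' -> i = k.
Proof.
move=> ci ck sw sw' E.
have := A8 axC sw sw' (comp_strong ci) (comp_strong ck) E.
case=> -[h [_ hE]]; first exact: comp_factor hE.
by symmetry; apply: comp_factor hE.
Qed.

Lemma exists_comp_point X (j : hom one X) : X <> one ->
  exists2 k : arrow_into X, Comp k & exists w : hom one (src k), arr k ∘ w = j.
Proof.
move=> X1; have [|k ck [w _ E]] := exists_comp (point_strong j); last by exists k => //; exists w.
by move=> idj; apply: X1; case: idj.
Qed.

Lemma is_pullback_is_id X Y Z (f : hom X Z) (g : hom Y Z)
    P (p : hom P X) (r : hom P Y) P' (x : hom P P') (p' : hom P' X) (r' : hom P' Y) :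
  is_pullback f g p' r' -> is_id x -> p' ∘ x = p -> r' ∘ x = r -> is_pullback f g p r.
Proof. by move=> pb idx; case: idx p' r' pb => p' r'; rewrite !cmpm1 => pb <- <-. Qed.

(** The image of d i is proper by [epi_restriction_id], hence lies in a component k. Since i factors
    through the preimage of k, indecomposability makes i equal to that preimage, unless the preimage
    is all of X; but then k would be an epimorphism. *)
Lemma comp_image_pullback X Y (d : hom X Y) (i : arrow_into X) :
  epi d -> Y <> one -> Comp i ->
  exists2 k : arrow_into Y, Comp k &
    exists2 e : hom (src i) (src k), epi e & is_pullback d (arr k) (arr i) e.
Proof.
move=> ed Y1 ci; have [M [e0 [m [ee0 sm dE]]]] := A2 axC (d ∘ arr i).
have nm : ~ is_id m.
  move=> idm; apply: (comp_nid ci); apply: (epi_restriction_id ed) => //.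
    exact: comp_strong.
  by rewrite dE; apply: epi_cmp => //; apply/iso_epi/is_id_iso.
have [k ck [w sw kw]] := exists_comp sm nm.
have [P [p [r [pb er]]]] := A3 axC ed (comp_strong ck).
have sp := pullback_strong pb (comp_strong ck).
have [E U] := pb.
have [|x [[px _] _]] := U _ (arr i) (w ∘ e0); first by rewrite dE cmpA kw.
have sx : strong_mono x by apply: (@strong_cancel _ _ _ _ p); rewrite px; apply: comp_strong.
exists k => //.
have [idx|idp] : is_id x \/ is_id p by case: ci => _ _; apply.
  exists (r ∘ x); first by apply: epi_cmp => //; apply/iso_epi/is_id_iso.
  exact: (is_pullback_is_id pb idx).
case: (comp_nid ck); apply: epi_strong_id; last exact: comp_strong.
apply: (@epi_cancel _ _ _ _ _ r); rewrite -E; apply: epi_cmp => //.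
exact/iso_epi/is_id_iso.
Qed.

(** The preimage of k lies in a component i, which is itself the full preimage of some component k'.
    Then k factors through k', so k = k'. *)
Lemma exists_comp_over X Y (d : hom X Y) (k : arrow_into Y) :
  epi d -> Comp k ->
  exists2 i : arrow_into X, Comp i &
    exists2 e : hom (src i) (src k), epi e & is_pullback d (arr k) (arr i) e.
Proof.
move=> ed ck; have Y1 := comp_neq_one ck.
have [P [p [r [pb er]]]] := A3 axC ed (comp_strong ck).
have sp := pullback_strong pb (comp_strong ck).
have [E U] := pb.
have np : ~ is_id p.
  move=> idp; apply: (comp_nid ck); apply: epi_strong_id; last exact: comp_strong.
  apply: (@epi_cancel _ _ _ _ _ r); rewrite -E; apply: epi_cmp => //.
  exact/iso_epi/is_id_iso.
have [i ci [x sx ix]] := exists_comp sp np.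
have [k' ck' [e' ee' pb']] := comp_image_pullback ed Y1 ci.
have [N [f [n [ef sn e'xE]]]] := A2 axC (e' ∘ x).
have [||h _ [hk _]] := @factorization_unique _ _ _ _ r (arr k) _ f (arr k' ∘ n) er
    (comp_strong ck) ef; first exact: strong_cmp (comp_strong ck') sn.
  by rewrite -E -ix cmpA pb'.1 -cmpA e'xE cmpA.
have Ek : k = k' by apply: (@comp_factor _ _ _ (n ∘ h)) => //; rewrite cmpA.
subst k'.
have [y [[py _] _]] := U _ _ _ pb'.1.
exists i => //; exists e' => //.
Qed.

Lemma sigma_inj X Y (d : hom X Y) (i i' : arrow_into X) (k : arrow_into Y)
    (e : hom (src i) (src k)) (e' : hom (src i') (src k)) :
  epi d -> Comp i -> Comp i' -> Comp k ->
  d ∘ arr i = arr k ∘ e -> d ∘ arr i' = arr k ∘ e' -> i = i'.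
Proof.
move=> ed ci ci' ck E E'.
have [i0 c0 [e0 _ [_ U]]] := exists_comp_over ed ck.
have [x [[ix _] _]] := U _ _ _ E; have [x' [[ix' _] _]] := U _ _ _ E'.
by rewrite (comp_factor ci c0 ix) (comp_factor ci' c0 ix').
Qed.

Lemma sigma_pullback X Y (d : hom X Y) (i : arrow_into X) (k : arrow_into Y)
    (e : hom (src i) (src k)) :
  epi d -> Comp i -> Comp k -> d ∘ arr i = arr k ∘ e ->
  epi e /\ is_pullback d (arr k) (arr i) e.
Proof.
move=> ed ci ck E; have [i0 c0 [e0 ee0 pb]] := exists_comp_over ed ck.
have E0 : i0 = i by apply: sigma_inj pb.1 E.
subst i0; suff -> : e = e0 by [].
by case: (comp_strong ck) => mk _; apply: mk; rewrite -E pb.1.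
Qed.

Lemma comp_sigma X Y (d : hom X Y) (i : arrow_into X) (k : arrow_into Y) :
  epi d -> Y <> one -> Comp i -> sigma d i k -> Comp k.
Proof.
move=> ed Y1 ci [e [ee sk E]]; have [k' ck' [e' ee' pb]] := comp_image_pullback ed Y1 ci.
have [|h isoh [hk _]] := factorization_unique ee sk ee' (comp_strong ck').
  by rewrite -E pb.1.
suff -> : k = k' by [].
by rewrite -(arrow_into_cmp_id (iso_is_id isoh)) hk arrow_into_eta.
Qed.

(** Each point of Y lies in a component, over which d restricts to a strong epimorphism, that is, to
    an isomorphism. So every fibre over a point is a point and A9 applies. *)
Lemma epi_iso_of_strong_comps X Y (d : hom X Y) : epi d -> Y <> one ->
  (forall i, Comp i -> strong_mono (d ∘ arr i)) -> is_iso d.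
Proof.
move=> ed Y1 H; apply: is_id_iso; apply: (A9 axC) => // w.
have [k ck [w' kw]] := exists_comp_point w Y1.
have [i ci [e ee pb]] := exists_comp_over ed ck.
have se : strong_mono e.
  by apply: (@strong_cancel _ _ _ _ (arr k)); rewrite -pb.1; apply: H.
have [f [fe ef]] := epi_strong_iso ee se.
exists one, (arr i ∘ (f ∘ w')), (idm one); split; last exact: idm_iso.
have [E U] := pb; apply: is_pullback_mono.
- by case: (point_strong (arr i ∘ (f ∘ w'))).
- by case: (point_strong w).
- by rewrite cmpA E -cmpA (cmpA e) ef cmp1m kw cmpm1.
move=> W a b Eab; have [|y [[iy ey] _]] := U _ a (w' ∘ b); first by rewrite Eab cmpA kw.
by exists b; rewrite -!cmpA -ey (cmpA f) fe cmp1m.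
Qed.

End Components.

(** * Pushouts along components and reductions *)

Section Nodes.
Variables (C : category) (one : C) (q : forall X : C, hom X one).
Hypothesis axC : nine_axioms q.
Implicit Types X Y Z A B W : C.

Lemma sigma_fun X Y (d : hom X Y) (i : arrow_into X) (k k' : arrow_into Y)
    (e : hom (src i) (src k)) (e' : hom (src i) (src k')) :
  epi d -> Comp i -> Comp k -> Comp k' ->
  d ∘ arr i = arr k ∘ e -> d ∘ arr i = arr k' ∘ e' -> k = k'.
Proof.
move=> ed ci ck ck' E E'.
have [ee _] := sigma_pullback axC ed ci ck E.
have [ee' _] := sigma_pullback axC ed ci ck' E'.
have [|h _ [hk _]] := factorization_unique ee (comp_strong ck) ee' (comp_strong ck').
  by rewrite -E E'.
exact: comp_factor hk.
Qed.

Lemma pushout_comp X (u : arrow_into X) B (a : hom (src u) B) Y (c : hom X Y) (v : hom B Y) :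
  Comp u -> epi a -> is_pushout (arr u) a c v -> strong_mono v ->
  is_pullback c v (arr u) a -> Comp (ArrowInto v).
Proof.
move=> cu ea po sv pb; have su := comp_strong cu.
apply: (@comp_sigma _ _ _ axC _ _ c u) => //; last by exists a; split=> //; case: po.
  exact: pushout_epi po ea.
(* If Y were [one], then v would be an identity and its pullback u would be invertible. *)
move=> Y1; subst Y; apply: (comp_nid cu); apply: (iso_is_id axC).
by apply: (pullback_iso pb); [case: su|apply/is_id_iso/(strong_to_one axC)].
Qed.

Lemma pushout_iso X B Z (u : hom Z X) (a : hom Z B) Y (c : hom X Y) (v : hom B Y) :
  is_pushout u a c v -> is_iso a -> is_iso c.
Proof.
move=> po isoa; have ec := pushout_epi po (iso_epi isoa).
have [a' [a'a _]] := isoa; case: po => _ U.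
have [|h [[hc _] _]] := U X (idm X) (u ∘ a'); first by rewrite cmp1m -cmpA a'a cmpm1.
exact: epi_split_iso hc.
Qed.

(** By A5 the collapse of u is a one-point epimorphism, and unless u is already a point, the
    exceptional point is z. Another component i lands in a component k that does not contain z, so
    its restriction e has only invertible fibres and is an identity by A9. *)
Lemma collapse_strong X (u i : arrow_into X) Z (c : hom X Z) (z : hom one Z) :
  Comp u -> Comp i -> i <> u ->
  is_pushout (arr u) (q (src u)) c z -> is_pullback c z (arr u) (q (src u)) ->
  strong_mono (c ∘ arr i).
Proof.
move=> cu ci niu po pb.
have eq := q_epi axC (A := src u).
case: (pselect (is_iso (q (src u)))) => [isoq|nisoq].
  by apply: strong_cmp (comp_strong ci); apply/iso_strong/(pushout_iso po).
have ec := pushout_epi po eq.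
have cz := pushout_comp cu eq po (point_strong axC z) pb.
have [k ck [e ee pbk]] := comp_image_pullback axC ec (comp_neq_one axC cz) ci.
have c1 : one_point_epi one c.
  apply: (A5 axC _ (comp_strong cu) po).
  by split=> // j k' _ _; apply: (to_one axC).
suff ide : is_id e.
  by rewrite pbk.1; apply: strong_cmp (comp_strong ck) _; apply/iso_strong/is_id_iso.
apply: (A9 axC) => // w.
have nz : arr k ∘ w <> z.
  move=> E; apply: niu; have Ek : ArrowInto z = k.
    apply: (@comp_disjoint _ _ _ axC _ (ArrowInto z) k _ (idm one) w) => //=.
    - exact: (point_strong axC).
    - exact: (point_strong axC).
    - by rewrite cmpm1.
  by subst k; apply: (sigma_inj axC ec ci cu cz pbk.1 po.1).
(* The fibre over z is [q (src u)], which is not invertible, so z uses up the one exception. *)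
have [P [p [r [pbw isor]]]] : pullback_iso_along c (arr k ∘ w).
  apply: contrapT => H; apply: nz; apply: c1.2 => // -[P [p [r [pbP isor]]]].
  have [h isoh [_ rh]] := pullback_iso_comparison pbP pb.
  by apply: nisoq; rewrite -rh; apply: iso_cmp.
have [_ U] := pbk; have [E V] := pbw.
have [|y [[iy ey] _]] := U _ p (w ∘ r); first by rewrite E cmpA.
exists P, y, r; split=> //; apply: is_pullback_mono.
- by case: (pullback_strong pbw (point_strong axC _)) => mp _ D f g /(congr1 (cmp (arr i)));
    rewrite !cmpA iy => /mp.
- by case: (point_strong axC w).
- exact: ey.
move=> D f g Efg; have [|x [[px _] _]] := V D (arr i ∘ f) g.
  by rewrite cmpA pbk.1 -!cmpA Efg.
exists x; have [mi _] := comp_strong ci; apply: mi.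
by rewrite cmpA iy.
Qed.

(** A5 is applied only to the collapse of u to [one]. That collapse factors through the pushout c of
    any epimorphism a, so c is strong wherever the collapse is. *)
Lemma comp_pushout X (u : arrow_into X) B (a : hom (src u) B) : Comp u -> epi a ->
  exists Y (c : hom X Y) (v : hom B Y),
    [/\ is_pushout (arr u) a c v, epi c, Comp (ArrowInto v) &
        forall i, Comp i -> i <> u -> Comp (ArrowInto (c ∘ arr i))].
Proof.
move=> cu ea; have su := comp_strong cu.
have [Y [c [v [po sv pb]]]] := A4 axC su ea.
have ec := pushout_epi po ea; have cv := pushout_comp cu ea po sv pb.
exists Y, c, v; split=> // i ci niu.
suff s : strong_mono (c ∘ arr i).
  apply: (@comp_sigma _ _ _ axC _ _ c i) => //; first exact: (comp_neq_one axC cv).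
  by exists (idm _); rewrite cmpm1; split=> //; apply/iso_epi/idm_iso.
have [Z [c' [z [po' _ pb']]]] := A4 axC su (q_epi axC (A := src u)).
have [|g [[gc _] _]] := po.2 _ c' (z ∘ q B).
  by rewrite po'.1 -cmpA (to_one axC (q B ∘ a) (q _)).
apply: (@strong_cancel _ _ _ _ g); rewrite cmpA gc.
exact: collapse_strong pb'.
Qed.

(** A common index set for the components of X and Y lets the later inductions run over a fixed list
    of indices while the object changes. *)
Lemma pushout_enumerates X n (u : 'I_n -> arrow_into X) p0 B (a : hom (src (u p0)) B) :
  enumerates (@Comp C X) u -> epi a ->
  exists Y (c : hom X Y) (u1 : 'I_n -> arrow_into Y) (v : hom B Y),
    [/\ is_pushout (arr (u p0)) a c v, epi c, enumerates (@Comp C Y) u1,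
        u1 p0 = ArrowInto v & forall p, p != p0 -> u1 p = ArrowInto (c ∘ arr (u p))].
Proof.
move=> [uinj uE] ea; have cu p : Comp (u p) by apply/uE; exists p.
have [Y [c [v [po ec cv H]]]] := comp_pushout (cu p0) ea.
pose u1 (p : 'I_n) := if p == p0 then ArrowInto v else ArrowInto (c ∘ arr (u p)).
have cu1 p : Comp (u1 p).
  by rewrite /u1; case: eqVneq => // np; apply: H => // /uinj /eqP; apply/negP.
have u1E p k : u1 p = k -> exists e : hom (src (u p)) (src k), c ∘ arr (u p) = arr k ∘ e.
  move=> <-; rewrite /u1; case: eqVneq => [->|_]; first by exists a; case: po.
  by exists (idm _); rewrite cmpm1.
exists Y, c, u1, v; split=> //; first split.
- move=> p p' Epp'; have [e E] := u1E p _ erefl; have [e' E'] := u1E p' _ (esym Epp').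
  by apply: uinj; apply: (sigma_inj axC ec _ _ (cu1 p) E E').
- move=> k; split=> [ck|[p <-] //].
  have [i ci [e _ [E _]]] := exists_comp_over axC ec ck.
  case/uE: ci => p Ep; subst i; exists p.
  have [e' E'] := u1E p _ erefl.
  by apply: (sigma_fun ec (cu p) _ ck E' E).
- by rewrite /u1 eqxx.
- by move=> p; rewrite /u1 => /negPf ->.
Qed.

Lemma comps_enumerated X : exists u : 'I_(Defs.card (@Comp C X)) -> arrow_into X,
  enumerates (@Comp C X) u.
Proof.
apply: card_eq_enumerates; apply: finite_set_card.
by apply: sub_finite_set (A7 axC X).1 => i; apply: comp_strong.
Qed.

(** The collapse of a component of a normal object is an identity, so that component was already a
    point. Conversely, an epimorphism is strong on components that are points, hence invertible if
    all of them are. *)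
Lemma normalP X : X <> one ->
  normal one X <-> forall i : arrow_into X, Comp i -> src i = one.
Proof.
move=> X1; split=> [nX i ci|H Y d [[ed Y1]|[]] //].
  have [Z [c [z [po ec cz _]]]] := comp_pushout ci (q_epi axC (A := src i)).
  have idc : is_id c by apply: nX; left; split=> //; exact: (comp_neq_one axC cz).
  have isoc := is_id_iso idc.
  have: is_id (q (src i)); last by case.
  apply: (epi_strong_id axC); first exact: (q_epi axC).
  apply: (@strong_cancel _ _ _ _ z); rewrite -po.1.
  exact/(strong_cmp _ (comp_strong ci))/iso_strong.
apply: (iso_is_id axC); apply: (epi_iso_of_strong_comps axC) => // i ci.
exact/(strong_src_one axC)/H.
Qed.

Lemma letterP X : is_letter one X <->
  X <> one /\ forall i : arrow_into X, Comp i -> src i = one.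
Proof.
split=> [[X1 [rho [_ nX]]]|[X1 H]]; first by split=> //; apply/normalP.
split=> //; exists (idm X); split; last exact/normalP.
by left; split=> //; apply/iso_epi/idm_iso.
Qed.

Lemma exists_reduction X : X <> one -> exists (N : C) (d : hom X N), is_letter one N /\ epi d.
Proof.
have [u eu] := comps_enumerated X; move: eu.
(* Invariant of the induction: components with index outside the list are points. *)
have: forall p, p \notin enum 'I_(Defs.card (@Comp C X)) -> src (u p) = one.
  by move=> p; rewrite mem_enum.
move: (Defs.card _) (enum _) u => n l u; elim: l X u => [|p0 l IH] X u Hl eu X1.
  exists X, (idm X); split; last exact/iso_epi/idm_iso.
  by apply/letterP; split=> // i /eu.2[p <-]; apply: Hl.
have [Y [c [u1 [v [_ ec eu1 u1v u1E]]]]] := pushout_enumerates eu (q_epi axC (A := src (u p0))).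
have Y1 : Y <> one by apply: (@comp_neq_one _ _ _ axC _ (u1 p0)); apply/eu1.2; exists p0.
have [p np|N [d [lN ed]]] := IH Y u1 _ eu1 Y1; last first.
  by exists N, (d ∘ c); split=> //; apply: epi_cmp.
have [->|npp] := eqVneq p p0; first by rewrite u1v.
by rewrite u1E //= Hl // inE negb_or npp.
Qed.

Lemma reduction_unique X N N' (d : hom X N) (d' : hom X N') :
  is_letter one N -> is_letter one N' -> epi d -> epi d' ->
  exists2 g : hom N N', is_id g & g ∘ d = d'.
Proof.
move=> /letterP[N1 HN] /letterP[N1' HN'].
have [u eu] := comps_enumerated X; move: eu.
have: forall p, p \notin enum 'I_(Defs.card (@Comp C X)) -> src (u p) = one.
  by move=> p; rewrite mem_enum.
move: (Defs.card _) (enum _) u => n l u; elim: l X u d d' => [|p0 l IH] X u d d' Hl eu ed ed'.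
  have H Y (f : hom X Y) : Y <> one -> epi f -> is_id f.
    move=> Y1 ef; apply: (iso_is_id axC); apply: (epi_iso_of_strong_comps axC) => //.
    by move=> i /eu.2[p <-]; apply: (strong_src_one axC); apply: Hl.
  have [g idg [gd dg]] := is_id_cancel (H _ _ N1 ed).
  exists (d' ∘ g); first by apply: is_id_cmp => //; apply: H.
  by rewrite -cmpA gd cmpm1.
have cu : Comp (u p0) by apply/eu.2; exists p0.
have [Y [c [u1 [v [po ec eu1 u1v u1E]]]]] := pushout_enumerates eu (q_epi axC (A := src (u p0))).
(* The components of M are points, so f is constant on the component at [p0] and factors through its
   collapse c. *)
have H M (f : hom X M) : M <> one -> (forall i : arrow_into M, Comp i -> src i = one) ->
    epi f -> exists2 g : hom Y M, epi g & g ∘ c = f.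
  move=> M1 HM ef; have [k /HM Ek [e _ [E _]]] := comp_image_pullback axC ef M1 cu.
  case: k Ek e E => K k /= EK e E; subst K.
  have [|g [[gc _] _]] := po.2 _ f k; first by rewrite E (to_one axC e (q _)).
  by exists g => //; apply: (@epi_cancel _ _ _ _ _ c); rewrite gc.
have [f ef <-] := H _ _ N1 HN ed; have [f' ef' <-] := H _ _ N1' HN' ed'.
have [p np|g idg <-] := IH Y u1 f f' _ eu1 ef ef'; last by exists g; rewrite // cmpA.
have [->|npp] := eqVneq p p0; first by rewrite u1v.
by rewrite u1E //= Hl // inE negb_or npp.
Qed.

(** Invariant: h is strong on the components outside the list. Both maps factor through the pushout
    along the epimorphism part of h on the component at [p0], after which h is strong there too.
    Once the list is empty, h and h' are identities. *)
Lemma epi_unique_of_comps X Y n (u : 'I_n -> arrow_into X) (h h' : hom X Y) :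
  enumerates (@Comp C X) u -> Y <> one -> epi h -> epi h' ->
  (forall p, h ∘ arr (u p) = h' ∘ arr (u p)) -> h = h'.
Proof.
move=> eu Y1.
have: forall p, p \notin enum 'I_n -> strong_mono (h ∘ arr (u p)).
  by move=> p; rewrite mem_enum.
move: (enum _) => l; elim: l X u h h' eu => [|p0 l IH] X u h h' eu Hl eh eh' E.
  have H (f : hom X Y) : epi f -> (forall p, strong_mono (f ∘ arr (u p))) -> is_id f.
    move=> ef Hf; apply: (iso_is_id axC); apply: (epi_iso_of_strong_comps axC) => //.
    by move=> i /eu.2[p <-].
  have idh : is_id h by apply: H => // p; apply: Hl.
  have : is_id h' by apply: H => // p; rewrite -E; apply: Hl.
  by case: idh h' {eh' E} => h' /is_id_eq.
have cu : Comp (u p0) by apply/eu.2; exists p0.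
have [k ck [e ee [Ee _]]] := comp_image_pullback axC eh Y1 cu.
have [Z [c [u1 [v [po ec eu1 u1v u1E]]]]] := pushout_enumerates eu ee.
have [g [[gc gv] _]] := po.2 _ _ _ Ee.
have [|g' [[g'c g'v] _]] := po.2 _ h' (arr k); first by rewrite -E.
have Eu1 p : g ∘ arr (u1 p) = g' ∘ arr (u1 p).
  have [->|npp] := eqVneq p p0; first by rewrite u1v /= gv.
  by rewrite u1E //= !cmpA gc g'c.
rewrite -gc -g'c (IH _ u1 g g') //.
- move=> p np; have [->|npp] := eqVneq p p0; first by rewrite u1v /= gv; apply: comp_strong.
  by rewrite u1E //= cmpA gc; apply: Hl; rewrite inE negb_or npp.
- by apply: (@epi_cancel _ _ _ _ _ c); rewrite gc.
- by apply: (@epi_cancel _ _ _ _ _ c); rewrite g'c.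
Qed.

(* The terminal filling at a component point changes no other component:
   pushing out the restriction of d to another component gives a filling that
   maps back, so that restriction is an isomorphism. *)
Lemma graft_comp A B (j : hom one B) : Comp (ArrowInto j) ->
  exists D (d : hom D B) (u : hom A D),
    [/\ universal_filling q (fun _ : unit => j) (A := fun _ => A) d (fun _ => u),
        Comp (ArrowInto u) &
        forall i : arrow_into D, Comp i -> i <> ArrowInto u -> strong_mono (d ∘ arr i)].
Proof.
move=> cj; have B1 := comp_neq_one axC cj.
have [D [d [u univ]]] := A6 axC A j; have [[ed /(_ tt)[su pbu]] U] := univ.
have fiberE Y (f : hom Y B) (w : hom A Y) : epi f -> f ∘ w = j ∘ q A ->
    strong_mono w -> ~ is_id w -> is_pullback f j w (q A) -> Comp (ArrowInto w).
  move=> ef E sw nw pb; have [i ci [e ee pb']] := exists_comp_over axC ef cj.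
  have [h isoh [ph _]] := pullback_iso_comparison pb' pb.
  suff -> : ArrowInto w = i by [].
  by rewrite -(arrow_into_cmp_id (iso_is_id axC isoh)) ph.
have nu : ~ is_id u.
  move=> idu; have ej : epi j.
    apply: (@epi_cancel _ _ _ _ _ (q A)); rewrite -pbu.1.
    by apply: epi_cmp => //; apply/iso_epi/is_id_iso.
  by apply: (comp_nid cj); apply: (epi_strong_id axC) => //; apply: comp_strong.
have cu : Comp (ArrowInto u) by apply: fiberE pbu.1 _ _ _.
exists D, d, u; split=> // i ci niu.
have [k ck [e ee [E _]]] := comp_image_pullback axC ed B1 ci.
have [Z [c [v [po ec cv H]]]] := comp_pushout ci ee.
have ccu : Comp (ArrowInto (c ∘ u)) by apply: (H (ArrowInto u)) => // /esym.
have [h [[hc hv] _]] := po.2 _ _ _ E.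
have eh : epi h by apply: (@epi_cancel _ _ _ _ _ c); rewrite hc.
have [|_ pbcu] := @sigma_pullback _ _ _ axC _ _ h (ArrowInto (c ∘ u)) (ArrowInto j) (q A)
  eh ccu cj.
  by rewrite /= cmpA hc pbu.1.
have [g [[dg gcu] _]] : exists! g : hom Z D, d ∘ g = h /\ (unit -> g ∘ (c ∘ u) = u).
  by apply: (U Z h (fun _ => c ∘ u)); split=> // _; split=> //; exact: comp_strong ccu.
have gc : g ∘ c = idm D.
  have [x [_ Ux]] : exists! x : hom D D, d ∘ x = d /\ (unit -> x ∘ u = u).
    by apply: (U D d (fun _ => u)); split.
  rewrite -(Ux (idm D)); last by split=> [|_]; rewrite ?cmpm1 ?cmp1m.
  by rewrite (Ux (g ∘ c)) //; split=> [|_]; rewrite ?cmpA ?dg // -cmpA; apply: gcu.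
have isoc := epi_split_iso ec gc.
rewrite E; apply: (strong_cmp (comp_strong ck)); apply: (@strong_cancel _ _ _ _ v).
by rewrite -po.1; apply: strong_cmp (comp_strong ci); apply: iso_strong.
Qed.

(** Both objects are the terminal filling D. The comparison map h to D is an epimorphism, since d0
    is one on its image, and it is strong on every component: on A it is u0, and elsewhere already
    its composite with d0 is strong. *)
Lemma graft_unique A B (j : hom one B) X X' (d : hom X B) (d' : hom X' B)
    (u : hom A X) (u' : hom A X') :
  Comp (ArrowInto j) -> epi d -> epi d' ->
  Comp (ArrowInto u) -> Comp (ArrowInto u') -> d ∘ u = j ∘ q A -> d' ∘ u' = j ∘ q A ->
  (forall i : arrow_into X, Comp i -> i <> ArrowInto u -> strong_mono (d ∘ arr i)) ->
  (forall i : arrow_into X', Comp i -> i <> ArrowInto u' -> strong_mono (d' ∘ arr i)) ->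
  exists2 g : hom X X', is_iso g & d' ∘ g = d.
Proof.
move=> cj ed ed' cu cu' E E' H H'; have B1 := comp_neq_one axC cj.
have [D [d0 [u0 [[[ed0 _] U] cu0 _]]]] := graft_comp A cj.
have D1 := comp_neq_one axC cu0.
have toD Y (f : hom Y B) (w : hom A Y) : epi f -> Comp (ArrowInto w) -> f ∘ w = j ∘ q A ->
    (forall i : arrow_into Y, Comp i -> i <> ArrowInto w -> strong_mono (f ∘ arr i)) ->
    exists2 h : hom Y D, is_iso h & d0 ∘ h = f.
  move=> ef cw Ef Hf.
  have [|h [[d0h hw] _]] := U Y f (fun _ => w).
    split=> // _; split; first exact: comp_strong cw.
    by have [] := @sigma_pullback _ _ _ axC _ _ f (ArrowInto w) (ArrowInto j) (q A) ef cw cj Ef.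
  exists h => //.
  have [M [e [m [ee sm hE]]]] := A2 axC h.
  have idm : is_id m.
    apply: (epi_restriction_id axC ed0 B1 sm); apply: (@epi_cancel _ _ _ _ _ e).
    by rewrite -cmpA -hE d0h.
  have eh : epi h by rewrite hE; apply: epi_cmp => //; apply/iso_epi/is_id_iso.
  apply: (epi_iso_of_strong_comps axC) => // i ci.
  have [Ei|ni] := pselect (i = ArrowInto w); first by rewrite Ei /= (hw tt); apply: comp_strong cu0.
  by apply: (@strong_cancel _ _ _ _ d0); rewrite cmpA d0h; apply: Hf.
have [h isoh hE] := toD _ _ _ ed cu E H.
have [h' isoh' h'E] := toD _ _ _ ed' cu' E' H'.
have [k [kh' h'k]] := isoh'.
exists (k ∘ h); first by apply: iso_cmp => //; exists h'.
by rewrite cmpA -h'E -(cmpA d0) h'k cmpm1 hE.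
Qed.

End Nodes.

(** * Trees and the free operad *)

Lemma map_constant (S T : Type) (c : T) (s : seq S) : [seq c | _ <- s] = nseq (size s) c.
Proof. by elim: s => //= _ s ->. Qed.

Section TreeCombinatorics.
Variable L : ranked_set.
Implicit Types (T X Y Z : tree L) (a b : seq nat).

Lemma insub_ord n (i : 'I_n) : insub (val i) = Some i.
Proof. exact: valK. Qed.

(** Listed in the order in which [graft] consumes its arguments. *)
Fixpoint leaf_addresses T : seq (seq nat) :=
  match T with
  | Leaf => [:: [::]]
  | @Node _ l ts =>
      flatten [seq [seq val i :: a | a <- leaf_addresses (ts i)] | i <- enum 'I_(rank l)]
  end.

Lemma size_leaf_addresses T : size (leaf_addresses T) = leaves T.
Proof.
elim: T => //= l ts IH; rewrite size_flatten /shape -map_comp.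
by congr sumn; apply: eq_map => i /=; rewrite size_map IH.
Qed.

Lemma mem_leaf_addresses T a :
  a \in leaf_addresses T <-> is_pos T a /\ subtree T a = @Leaf L.
Proof.
elim: T a => [|l ts IH] a /=.
  by rewrite inE; split=> [/eqP -> //|[]]; case: a.
split=> [/flatten_mapP[i _ /mapP[b /IH[pb sb] ->]]|].
  by rewrite /= insub_ord.
case: a => [[]|k b] //=; case: insubP => [i _ <-|_ []] //.
move=> /IH ib; apply/flatten_mapP; exists i; first by rewrite mem_enum.
exact: map_f.
Qed.

Lemma graft_node l (ts : 'I_(rank l) -> tree L) (B : 'I_(rank l) -> seq (tree L)) :
  (forall i, size (B i) = leaves (ts i)) ->
  graft (@Node L l ts) (flatten [seq B i | i <- enum 'I_(rank l)]) =
  Node (fun i => graft (ts i) (B i)).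
Proof.
move=> sB /=; congr Node; apply/funext => i; congr graft.
have -> : [seq leaves (ts j) | j <- enum 'I_(rank l)] =
    shape [seq B j | j <- enum 'I_(rank l)].
  by rewrite /shape -map_comp; apply: eq_map => j /=; rewrite sB.
by rewrite flattenK (nth_map i) ?size_enum_ord // nth_ord_enum.
Qed.

Lemma graft_blocks l (ts : 'I_(rank l) -> tree L) (T : Type) (s : seq T) :
  size s = leaves (@Node L l ts) ->
  exists2 B : 'I_(rank l) -> seq T, (forall i, size (B i) = leaves (ts i)) &
    s = flatten [seq B i | i <- enum 'I_(rank l)].
Proof.
move=> /= ss; set sh := map _ _ in ss.
exists (fun i => nth [::] (reshape sh s) i) => [i|]; first exact: size_nth_reshape.
by rewrite (map_nth_enum id) ?map_id ?reshapeKr ?ss // size_reshape size_map size_enum_ord.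
Qed.

Lemma graft_prunes T s : prunes (graft T s) T.
Proof. by elim: T s => [|l ts IH] s /=; constructor. Qed.

(** With [graft_prunes] and [subtrees_graft] this identifies the trees that prune to T with lists of
    trees, one for each empty leaf of T. *)
Lemma graft_subtrees X T : prunes X T ->
  graft T [seq subtree X a | a <- leaf_addresses T] = X.
Proof.
elim=> [X0|l xs ts _ IH]; first by rewrite /= subtree0.
rewrite [leaf_addresses _]/= map_flatten -map_comp -[RHS]/(Node (fun i => xs i)).
rewrite (@graft_node l ts) => [|i].
  congr Node; apply/funext => i; rewrite -[RHS]IH /= -map_comp; congr graft.
  by apply: eq_map => a /=; rewrite insub_ord.
by rewrite !size_map size_leaf_addresses.
Qed.

Lemma subtrees_graft T s : size s = leaves T ->
  [seq subtree (graft T s) a | a <- leaf_addresses T] = s.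
Proof.
elim: T s => [|l ts IH] s.
  by case: s => [|x [|y s]] //= _; rewrite subtree0.
case/graft_blocks => B sB ->; rewrite graft_node //= map_flatten -map_comp.
congr flatten; apply: eq_map => i /=; rewrite -map_comp -[RHS](IH _ _ (sB i)).
by apply: eq_map => a /=; rewrite insub_ord.
Qed.

Lemma zip_flatten_enum n (S T : Type) (f : 'I_n -> seq S) (g : 'I_n -> seq T) :
  (forall i, size (f i) = size (g i)) ->
  zip (flatten [seq f i | i <- enum 'I_n]) (flatten [seq g i | i <- enum 'I_n]) =
  flatten [seq zip (f i) (g i) | i <- enum 'I_n].
Proof.
move=> E; elim: (enum _) => //= i s IH.
by rewrite zip_cat // IH.
Qed.

Lemma leaf_addresses_graft T s : size s = leaves T ->
  leaf_addresses (graft T s) =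
  flatten [seq [seq p.1 ++ b | b <- leaf_addresses p.2] | p <- zip (leaf_addresses T) s].
Proof.
elim: T s => [|l ts IH] s.
  by case: s => [|x [|y s]] //= _; rewrite cats0 -[LHS]map_id; apply: eq_map.
case/graft_blocks => B sB ->; rewrite graft_node //=.
rewrite zip_flatten_enum => [|i]; last by rewrite size_map size_leaf_addresses sB.
rewrite map_flatten -map_comp -flatten_flatten -map_comp.
congr flatten; apply: eq_map => i /=; rewrite IH //= map_flatten -map_comp.
congr flatten; elim: (leaf_addresses _) (B i) => [|a la IHla] [|t ss] //=.
by rewrite IHla -map_comp.
Qed.

Lemma prunes_leafE T : prunes (@Leaf L) T -> T = @Leaf L.
Proof. by move EX: (@Leaf L) => X H; case: H EX. Qed.

Lemma prunes_antisym X Y : prunes X Y -> prunes Y X -> X = Y.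
Proof.
elim=> [X0 /prunes_leafE //|l xs ts _ IH H].
case: (prunes_nodeE H) => // -[zs E Hz].
(* A dependent projection to the children; its default branch is not reached, as both sides are
   nodes. *)
have := inj_pair2 _ _ _ _ _ (congr1 (fun t => if t is @Node _ k f then
  existT (fun k => 'I_(rank k) -> tree L) k f else existT _ l xs) E).
move=> Exs; subst zs; congr Node; apply/funext => i; exact: IH.
Qed.

Lemma graft_corolla l (ts : 'I_(rank l) -> tree L) :
  graft (corolla l) [seq ts i | i <- enum 'I_(rank l)] = Node ts.
Proof.
rewrite -[map _ _]flatten_seq1 -map_comp.
by rewrite (@graft_node l (fun _ => @Leaf L) (fun i => [:: ts i])).
Qed.

Lemma leaves_corolla l : leaves (corolla l : tree L) = rank l.
Proof.
by rewrite /= map_constant sumn_nseq mul1n size_enum_ord.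
Qed.

End TreeCombinatorics.

(** * Freeness of the operad of trees *)

Section TreeOperadFree.
Variables (L : ranked_set) (U : Type) (Q : operad U) (f : L -> U).
Hypothesis Hf : forall l, arity Q (f l) = rank l.

Fixpoint tree_fold (T : tree L) : U :=
  match T with
  | Leaf => ounit Q
  | @Node _ l ts => ocomp Q (f l) [seq tree_fold (ts i) | i <- enum 'I_(rank l)]
  end.

Lemma arity_tree_fold T : arity Q (tree_fold T) = leaves T.
Proof.
elim: T => [|l ts IH] /=; first exact: arity_ounit.
rewrite arity_ocomp; last by rewrite size_map size_enum_ord Hf.
by rewrite -map_comp; congr sumn; apply: eq_map.
Qed.

Lemma tree_fold_graft T s : size s = leaves T ->
  tree_fold (graft T s) = ocomp Q (tree_fold T) [seq tree_fold t | t <- s].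
Proof.
elim: T s => [|l ts IH] s.
  by case: s => [|x [|y s]] //= _; rewrite ocomp1x.
case/graft_blocks => B sB ->; rewrite graft_node //= map_flatten -map_comp.
rewrite ocompA.
- congr ocomp; rewrite zip_map -map_comp.
  by apply: eq_map => i /=; rewrite IH.
- by rewrite size_map size_enum_ord Hf.
- by rewrite /shape -!map_comp; apply: eq_map => i /=; rewrite size_map sB arity_tree_fold.
Qed.

Lemma tree_fold_map : operad_map (tree_operad L) Q tree_fold.
Proof. by split=> [T||T s] /=; [exact: arity_tree_fold| |exact: tree_fold_graft]. Qed.

Lemma tree_fold_corolla l : tree_fold (corolla l) = f l.
Proof.
rewrite /= -[RHS](ocompx1 Q) Hf; congr ocomp.
by rewrite map_constant size_enum_ord.
Qed.

Lemma tree_fold_unique G : operad_map (tree_operad L) Q G ->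
  (forall l, G (corolla l) = f l) -> G =1 tree_fold.
Proof.
move=> [_ G1 Gc] Gf; elim=> [|l ts IH]; first exact: G1.
rewrite -[in LHS](graft_corolla ts) -[graft _ _]/(ocomp (tree_operad L) _ _) Gc; last first.
  by rewrite size_map size_enum_ord [RHS]leaves_corolla.
by rewrite Gf -map_comp /=; congr ocomp; apply: eq_map.
Qed.

End TreeOperadFree.

Lemma tree_operad_free (L : ranked_set) : is_free (tree_operad L) (@corolla L).
Proof.
split=> [l l' []|l|U Q f Hf] //; first exact: leaves_corolla.
exists (tree_fold Q f); first by split; [exact: tree_fold_map|exact: tree_fold_corolla].
exact: tree_fold_unique.
Qed.

(** * Objects with given components *)

(** An arbitrary enumeration is reindexed by sorting its indices. The reindexing v is an injection
    of a finite type into itself, hence bijective. *)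
Lemma sorted_enumeration T (A : set T) (R : T -> T -> Prop) :
  finite_set A -> linear_order_on A R ->
  exists2 u : 'I_(Defs.card A) -> T, enumerates A u &
    forall p p' : 'I_(Defs.card A), p < p' -> R (u p) (u p').
Proof.
move=> /finite_set_card/card_eq_enumerates; move: (Defs.card A) => n [u [uinj uE]] [_ Rtr Rtot].
have Au p : A (u p) by apply/uE; exists p.
pose le p p' := (p == p') || `[< R (u p) (u p') >].
have le_tr : transitive le.
  move=> y x z /orP[/eqP -> //|/asboolP xy] /orP[/eqP <-|/asboolP yz].
    by rewrite /le asboolT ?orbT.
  by rewrite /le asboolT ?orbT //; apply: Rtr yz.
have le_tot : total le.
  move=> x y; rewrite /le; case: (Rtot _ _ (Au x) (Au y)) => [H|/uinj ->|H].
  - by rewrite (asboolT H) orbT.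
  - by rewrite eqxx.
  - by rewrite (asboolT H) !orbT.
pose s := sort le (enum 'I_n).
have size_s : size s = n by rewrite size_sort size_enum_ord.
have uniq_s : uniq s by rewrite sort_uniq enum_uniq.
have ins (p : 'I_n) : p < size s by rewrite size_s.
pose v (p : 'I_n) := nth p s p.
have vinj : injective v.
  move=> p p' /eqP; rewrite /v (set_nth_default p p') // nth_uniq //.
  by move/eqP/val_inj.
exists (u \o v) => [|p p' lt].
  split=> [|x]; first exact: inj_comp.
  split=> [/uE[r <-]|[r <-]]; last exact: Au.
  by exists (invF vinj r); rewrite /= f_invF.
have : le (v p) (v p').
  rewrite /v (set_nth_default p p') //.
  by apply: sorted_ltn_nth; rewrite ?inE //; apply: sort_sorted.
rewrite /le => /orP[/eqP/vinj E|/asboolP //].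
by rewrite E ltnn in lt.
Qed.

Lemma letter_eq (C : category) (one : C) (phi phi' : derived_ranked_set one) :
  sval phi = sval phi' -> phi = phi'.
Proof. by case: phi phi' => X l [Y l'] /= E; subst Y; rewrite (Prop_irrelevance l l'). Qed.

Section LetterNodes.
Variables (C : category) (one : C) (q : forall X : C, hom X one).
Hypothesis axC : nine_axioms q.
Variable R : forall phi : C, arrow_into phi -> arrow_into phi -> Prop.
Hypothesis HR : linear_orders one R.
Implicit Types X Y Z A B W : C.

Local Notation L := (derived_ranked_set one).
Implicit Types phi : L.

Lemma exists_letter_points phi : exists pt : 'I_(rank phi) -> hom one (sval phi),
  enumerates (@Comp C (sval phi)) (fun p => ArrowInto (pt p)) /\
  forall p p' : 'I_(rank phi), p < p' -> R (ArrowInto (pt p)) (ArrowInto (pt p')).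
Proof.
have [_ H] := (letterP axC _).1 (svalP phi).
have fin : finite_set (@Comp C (sval phi)).
  by apply: sub_finite_set (A7 axC _).1 => i; apply: comp_strong.
have [u eu uR] := sorted_enumeration fin (HR (svalP phi)).
have /choice[pt Hpt] : forall p, exists f : hom one (sval phi), ArrowInto f = u p.
  by move=> p; apply: arrow_into_src; apply: H; apply/eu.2; exists p.
exists pt; have -> : (fun p => ArrowInto (pt p)) = u by apply/funext.
by split=> // p p'; rewrite !Hpt; apply: uR.
Qed.

(** The increasing enumeration of the input places: child p of a tree node with label phi belongs to
    the p-th place in the order [R]. *)
Definition letter_point phi : 'I_(rank phi) -> hom one (sval phi) :=
  projT1 (cid (exists_letter_points phi)).

Lemma letter_point_enumerates phi :
  enumerates (@Comp C (sval phi)) (fun p => ArrowInto (letter_point (phi := phi) p)).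
Proof. exact: (projT2 (cid (exists_letter_points phi))).1. Qed.

Lemma letter_point_sorted phi (p p' : 'I_(rank phi)) : p < p' ->
  R (ArrowInto (letter_point p)) (ArrowInto (letter_point p')).
Proof. exact: (projT2 (cid (exists_letter_points phi))).2. Qed.

Lemma letter_point_comp phi (p : 'I_(rank phi)) : Comp (ArrowInto (letter_point p)).
Proof. by apply/(letter_point_enumerates phi).2; exists p. Qed.

Lemma letter_point_inj phi : injective (letter_point (phi := phi)).
Proof. by move=> p p' E; apply: (letter_point_enumerates phi).1; rewrite E. Qed.

Lemma letter_neq_one phi : sval phi <> one.
Proof. by case: (svalP phi). Qed.

(* In tree terms: X = phi(src (u 0), ..., src (u (n - 1))). *)
Definition node X phi (rho : hom X (sval phi)) (u : 'I_(rank phi) -> arrow_into X) : Prop :=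
  epi rho /\ forall p, Comp (u p) /\ rho ∘ arr (u p) = letter_point p ∘ q (src (u p)).

Lemma node_neq_one X phi (rho : hom X (sval phi)) u : node rho u -> X <> one.
Proof. by case=> er _; apply: (epi_src_neq_one axC er); apply: letter_neq_one. Qed.

(** Since [q] is an epimorphism, the constant map [letter_point p ∘ q] determines p, so different
    indices give different components. *)
Lemma node_enumerates X phi (rho : hom X (sval phi)) u :
  node rho u -> enumerates (@Comp C X) u.
Proof.
move=> [er Hu]; split=> [p p' E|i].
  apply: letter_point_inj; apply: (@q_epi _ _ _ axC (src (u p))).
  by rewrite -(Hu p).2 E (Hu p').2.
split=> [ci|[p <-]]; last exact: (Hu p).1.
have [k ck [e ee [E _]]] := comp_image_pullback axC er (@letter_neq_one phi) ci.
have /(letter_point_enumerates phi).2[p Ep] := ck; subst k.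
by exists p; apply: (sigma_inj axC er (Hu p).1 ci ck (Hu p).2 E).
Qed.

Lemma node_of_epi X phi (rho : hom X (sval phi)) : epi rho -> exists u, node rho u.
Proof.
move=> er; suff /choice[u Hu] : forall p : 'I_(rank phi), exists i : arrow_into X,
    Comp i /\ rho ∘ arr i = letter_point p ∘ q (src i) by exists u.
move=> p; have [i ci [e _ [E _]]] := exists_comp_over axC er (letter_point_comp p).
by exists i; split=> //; rewrite E (to_one axC e (q _)).
Qed.

(** A map over phi cannot permute the components, because the place of a component is visible in
    phi. *)
Lemma node_epi_comps X X' phi (rho : hom X (sval phi)) u (rho' : hom X' (sval phi)) u'
    (h : hom X X') :
  node rho u -> node rho' u' -> epi h -> rho' ∘ h = rho ->
  forall p, exists2 e : hom (src (u p)) (src (u' p)), epi e & h ∘ arr (u p) = arr (u' p) ∘ e.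
Proof.
move=> nu nu' eh rh p; have [_ Hu] := nu; have [_ Hu'] := nu'.
have [k ck [e ee [E _]]] := comp_image_pullback axC eh (node_neq_one nu') (Hu p).1.
have /(node_enumerates nu').2[p' Ep'] := ck; subst k.
suff Epp : p' = p by subst p'; exists e.
apply: letter_point_inj; apply: (@q_epi _ _ _ axC (src (u p))).
rewrite -(Hu p).2 -rh -cmpA E cmpA (Hu' p').2 -cmpA.
by rewrite (to_one axC (q (src (u' p')) ∘ e) (q _)).
Qed.

(** The pushout stays over phi because rho is constant on the component at [p0]. *)
Lemma node_pushout X phi (rho : hom X (sval phi)) u p0 B (a : hom (src (u p0)) B) :
  node rho u -> epi a ->
  exists Y (c : hom X Y) (rho1 : hom Y (sval phi)) u1 (v : hom B Y),
    [/\ node rho1 u1, epi c /\ rho1 ∘ c = rho, c ∘ arr (u p0) = v ∘ a,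
        u1 p0 = ArrowInto v & forall p, p != p0 -> u1 p = ArrowInto (c ∘ arr (u p))].
Proof.
move=> nu ea; have [er Hu] := nu.
have [Y [c [u1 [v [po ec eu1 u1v u1E]]]]] := pushout_enumerates axC (node_enumerates nu) ea.
have [|rho1 [[rc rv] _]] := po.2 _ rho (letter_point p0 ∘ q B).
  by rewrite (Hu p0).2 -cmpA (to_one axC (q B ∘ a) (q _)).
exists Y, c, rho1, u1, v; split=> //; last by case: po.
split=> [|p]; first by apply: (@epi_cancel _ _ _ _ _ c); rewrite rc.
split; first by apply/eu1.2; exists p.
have [->|npp] := eqVneq p p0; first by rewrite u1v.
by rewrite u1E //= cmpA rc (Hu p).2.
Qed.

(** Collapsing the child at [p0] on both sides gives isomorphic objects by induction. X and X' then
    fill the same point of the same object by the same child, so [graft_unique] identifies them. *)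
Lemma node_unique X X' phi (rho : hom X (sval phi)) u (rho' : hom X' (sval phi)) u' :
  node rho u -> node rho' u' -> (forall p, src (u p) = src (u' p)) ->
  exists2 g : hom X X', is_iso g & rho' ∘ g = rho.
Proof.
have: forall p, p \notin enum 'I_(rank phi) -> src (u p) = one.
  by move=> p; rewrite mem_enum.
move: (enum _) => l; elim: l X rho u X' rho' u' => [|p0 l IH] X rho u X' rho' u' Hl nu nu' E.
  have H Y (r : hom Y (sval phi)) v : node r v -> (forall p, src (v p) = one) -> is_iso r.
    move=> nv Hv; apply: (epi_iso_of_strong_comps axC nv.1); first exact: letter_neq_one.
    by move=> i /(node_enumerates nv).2[p <-]; apply: (strong_src_one axC).
  have isor : is_iso rho by apply: H nu _ => p; apply: Hl.
  have [g [gr rg]] : is_iso rho' by apply: H nu' _ => p; rewrite -E; apply: Hl.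
  exists (g ∘ rho); first by apply: iso_cmp => //; exists rho'.
  by rewrite cmpA rg cmp1m.
have eq0 X0 : epi (q X0) by apply: (q_epi axC).
have [Y [c [r [w [v [nw [ec rc] cv wv wE]]]]]] := node_pushout (p0 := p0) nu (@eq0 _).
have [Y' [c' [r' [w' [v' [nw' [ec' rc'] cv' wv' wE']]]]]] := node_pushout (p0 := p0) nu' (@eq0 _).
have [p np|p|g isog rg] := IH _ _ _ _ _ _ _ nw nw'.
- have [->|npp] := eqVneq p p0; first by rewrite wv.
  by rewrite wE //= Hl // inE negb_or npp.
- by have [->|npp] := eqVneq p p0; [rewrite wv wv'|rewrite wE // wE' //= E].
have gv : g ∘ v = v'.
  have [e _] := node_epi_comps nw nw' (iso_epi isog) rg p0.
  by rewrite wv wv' /= in e * => ->; rewrite (to_one axC e (idm _)) cmpm1.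
have [f Ef] := arrow_into_src (esym (E p0)).
have cf : Comp (ArrowInto f) by rewrite Ef; apply: (nu'.2 p0).1.
have cv'C : Comp (ArrowInto v') by rewrite -wv'; apply: (nw'.2 p0).1.
have egc : epi (g ∘ c) by apply: epi_cmp => //; apply: iso_epi.
have [|||i ci ni|i ci ni|h isoh hE] :=
    @graft_unique _ _ _ axC _ _ _ _ _ (g ∘ c) c' (arr (u p0)) f cv'C egc ec' _ cf.
- by case: (u p0) (nu.2 p0).1.
- by rewrite -cmpA cv cmpA gv.
- by move: cv'; rewrite -Ef.
- have /(node_enumerates nu).2[p Ep] := ci; subst i.
  have npp : p != p0 by apply/eqP => Ep; subst p; apply: ni; case: (u p0).
  rewrite -cmpA; apply: strong_cmp; first exact: iso_strong.
  by have := comp_strong (nw.2 p).1; rewrite wE.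
- have /(node_enumerates nu').2[p Ep] := ci; subst i.
  have npp : p != p0 by apply/eqP => Ep; subst p; apply: ni.
  by have := comp_strong (nw'.2 p).1; rewrite wE'.
by exists h => //; rewrite -rc' -cmpA hE cmpA rg rc.
Qed.

(** The letter itself has only points as children. Each other child is inserted by the terminal
    filling of [graft_comp], which leaves the remaining children unchanged. *)
Lemma node_exists phi (A : 'I_(rank phi) -> C) :
  exists X (rho : hom X (sval phi)) u, node rho u /\ forall p, src (u p) = A p.
Proof.
have: forall p, p \notin enum 'I_(rank phi) -> A p = one.
  by move=> p; rewrite mem_enum.
move: (enum _) => l; elim: l A => [|p0 l IH] A Hl.
  exists (sval phi), (idm _), (fun p => ArrowInto (letter_point p)); split=> [|p].
    split=> [|p]; first exact/iso_epi/idm_iso.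
    split; first exact: letter_point_comp.
    by rewrite cmp1m /= (to_one axC (q one) (idm one)) cmpm1.
  by rewrite Hl.
have [p np|X [rho [u [nu uE]]]] := IH (fun p => if p == p0 then one else A p).
  by case: eqVneq => // npp; apply: Hl; rewrite inE negb_or npp.
have [j Ej] : exists j : hom one X, ArrowInto j = u p0.
  by apply: arrow_into_src; rewrite uE eqxx.
have cj : Comp (ArrowInto j) by rewrite Ej; apply: (nu.2 p0).1.
have [D [d [w [[[ed /(_ tt)[_ [dw _]]] _] cw Hw]]]] := graft_comp axC (A p0) cj.
have er : epi (rho ∘ d) by apply: epi_cmp => //; case: nu.
have [u' nu'] := node_of_epi er.
exists D, (rho ∘ d), u'; split=> // p.
have [e ee dE] := node_epi_comps nu' nu ed erefl p.
have [Epp|npp] := eqVneq p p0.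
  subst p; suff -> : u' p0 = ArrowInto w by [].
  move: e ee dE; rewrite -Ej => e _ dE.
  exact: (sigma_inj axC ed (nu'.2 p0).1 cw cj dE dw).
have nw : u' p <> ArrowInto w.
  move=> Ew; move/eqP: npp; apply; apply: (node_enumerates nu).1.
  rewrite -Ej; move: e ee dE; rewrite Ew /= => e _ dE.
  exact: (sigma_fun axC ed cw (nu.2 p).1 cj dE dw).
have se : strong_mono e.
  apply: (@strong_cancel _ _ _ _ (arr (u p))); rewrite -dE.
  exact: Hw (nu'.2 p).1 nw.
by rewrite (is_id_ob (epi_strong_id axC ee se)) uE (negPf npp).
Qed.

(** Pushouts replace the children of X one by one by those of X', until [node_unique] applies. *)
Lemma node_map X X' phi (rho : hom X (sval phi)) u (rho' : hom X' (sval phi)) u' :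
  node rho u -> node rho' u' ->
  (forall p, exists e : hom (src (u p)) (src (u' p)), epi e) ->
  exists2 h : hom X X', epi h & rho' ∘ h = rho.
Proof.
move=> + nu'.
have: forall p, p \notin enum 'I_(rank phi) -> src (u p) = src (u' p).
  by move=> p; rewrite mem_enum.
move: (enum _) => l; elim: l X rho u => [|p0 l IH] X rho u Hl nu He.
  have [|g isog rg] := node_unique nu nu'; first by move=> p; apply: Hl.
  by exists g => //; apply: iso_epi.
have [e ee] := He p0.
have [Y [c [r [w [v [nw [ec rc] cv wv wE]]]]]] := node_pushout nu ee.
have [p np||h eh rh] := IH _ _ _ _ nw.
- have [->|npp] := eqVneq p p0; first by rewrite wv.
  by rewrite wE //= Hl // inE negb_or npp.
- move=> p; have [->|npp] := eqVneq p p0; last by rewrite wE //; apply: He.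
  by rewrite wv; exists (idm _); apply/iso_epi/idm_iso.
by exists (h ∘ c); [apply: epi_cmp|rewrite cmpA rh].
Qed.

Lemma exists_node X : X <> one -> exists phi (rho : hom X (sval phi)) u, node rho u.
Proof.
move=> /(exists_reduction axC)[N [d [lN ed]]].
exists (exist _ N lN), d; exact: (@node_of_epi X (exist _ N lN)).
Qed.

Lemma node_letter_unique X phi (rho : hom X (sval phi)) phi' (rho' : hom X (sval phi')) :
  epi rho -> epi rho' -> phi = phi'.
Proof.
move=> er er'; have [g /is_id_ob E _] := reduction_unique axC (svalP phi) (svalP phi') er er'.
exact: letter_eq E.
Qed.

Lemma reduction_epi_unique X phi (rho rho' : hom X (sval phi)) :
  epi rho -> epi rho' -> rho = rho'.
Proof.
move=> er er'; have [g /is_id_eq -> <-] := reduction_unique axC (svalP phi) (svalP phi) er er'.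
by rewrite cmp1m.
Qed.

(** Uniqueness of reductions makes h and h' agree over the letter of Y, so they send each component
    to the same component. There they agree by induction on the measure, and [epi_unique_of_comps]
    concludes. *)
Lemma epi_unique X Y (h h' : hom X Y) : epi h -> epi h' -> h = h'.
Proof.
have [m Hm] := strong_measure axC.
suff H n : forall X, m X < n -> forall Y (h h' : hom X Y), epi h -> epi h' -> h = h'.
  exact: (H _ _ (ltnSn (m X))).
elim: n => // n IH {}X ltX {}Y {}h {}h' eh eh'.
have [Y1|Y1] := pselect (Y = one); first by subst Y; apply: (to_one axC).
have [phi [rho [v nv]]] := exists_node Y1.
have er : epi (rho ∘ h) by apply: epi_cmp => //; case: nv.
have er' : epi (rho ∘ h') by apply: epi_cmp => //; case: nv.
have E := reduction_epi_unique er' er.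
have [u nu] := node_of_epi er.
apply: (epi_unique_of_comps axC (node_enumerates nu) Y1 eh eh') => p.
have [e ee ->] := node_epi_comps nu nv eh erefl p.
have [e' ee' ->] := node_epi_comps nu nv eh' E p.
have [si ni _] := (nu.2 p).1.
by rewrite (IH _ _ _ e e') // (leq_trans (Hm _ _ _ si ni)).
Qed.

(** * Objects as trees *)

(** The arrows have source literally [A p], so the children in [tree_ob] are typed by the objects of
    the subtrees without transport. *)
Record node_data phi (A : 'I_(rank phi) -> C) := NodeData {
  node_ob : C;
  node_rho : hom node_ob (sval phi);
  node_arr : forall p, hom (A p) node_ob;
  node_dataP : node node_rho (fun p => ArrowInto (node_arr p))
}.

Lemma node_data_inhabited phi (A : 'I_(rank phi) -> C) : inhabited (node_data A).
Proof.
have [X [rho [u [nu uE]]]] := node_exists A.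
pose f p := projT1 (cid (arrow_into_src (uE p))).
have Ef : (fun p => ArrowInto (f p)) = u.
  by apply/funext => p; apply: (projT2 (cid (arrow_into_src (uE p)))).
by rewrite -Ef in nu; split; exists X rho f.
Qed.

Definition get_node phi (A : 'I_(rank phi) -> C) : node_data A :=
  inhabited_witness (node_data_inhabited A).

Implicit Types (S T : tree L) (a b : seq nat).

Fixpoint tree_ob T : C :=
  match T with
  | Leaf => one
  | @Node _ l ts => node_ob (@get_node l (fun i => tree_ob (ts i)))
  end.

Definition root_map (l : L) (ts : 'I_(rank l) -> tree L) :
    hom (tree_ob (Node ts)) (sval l) :=
  node_rho (@get_node l (fun i => tree_ob (ts i))).

Definition child (l : L) (ts : 'I_(rank l) -> tree L) (p : 'I_(rank l)) :
    hom (tree_ob (ts p)) (tree_ob (Node ts)) :=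
  node_arr (@get_node l (fun i => tree_ob (ts i))) p.

Lemma tree_node (l : L) (ts : 'I_(rank l) -> tree L) :
  node (root_map ts) (fun p => ArrowInto (child ts p)).
Proof. exact: node_dataP. Qed.

Lemma child_comp (l : L) (ts : 'I_(rank l) -> tree L) p : Comp (ArrowInto (child ts p)).
Proof. by case: ((tree_node ts).2 p). Qed.

Lemma tree_ob_node_neq_one (l : L) (ts : 'I_(rank l) -> tree L) : tree_ob (Node ts) <> one.
Proof. exact: node_neq_one (tree_node ts). Qed.

Lemma tree_ob_one T : tree_ob T = one -> T = @Leaf L.
Proof. by case: T => // l ts /tree_ob_node_neq_one. Qed.

Lemma tree_ob_surj X : exists T, tree_ob T = X.
Proof.
have [m Hm] := strong_measure axC.
suff H n : forall Y, m Y < n -> exists T, tree_ob T = Y by exact: (H _ _ (ltnSn (m X))).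
elim: n => // n IH Y ltY.
have [Y1|Y1] := pselect (Y = one); first by exists (@Leaf L).
have [phi [rho [u nu]]] := exists_node Y1.
have /choice[ts Hts] : forall p : 'I_(rank phi), exists T, tree_ob T = src (u p).
  move=> p; have [si ni _] := (nu.2 p).1; apply: IH.
  exact: leq_trans (Hm _ _ _ si ni) _.
exists (Node ts); have [g isog _] := node_unique (tree_node ts) nu Hts.
exact: is_id_ob (iso_is_id axC isog).
Qed.

Lemma epi_prunes S T (e : hom (tree_ob S) (tree_ob T)) : epi e -> prunes S T.
Proof.
elim: S T e => [|l ss IH] T e ee.
  by rewrite (@tree_ob_one T) -?(is_id_ob (epi_from_one axC ee)) //; constructor.
case: T e ee => [|l' ts] e ee; first by constructor.
have ete : epi (root_map ts ∘ e) by apply: epi_cmp => //; case: (tree_node ts).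
have E := node_letter_unique (tree_node ss).1 ete; subst l'.
have Er := reduction_epi_unique ete (tree_node ss).1.
constructor=> p; have [ep eep _] := node_epi_comps (tree_node ss) (tree_node ts) ee Er p.
exact: IH eep.
Qed.

Lemma prunes_epi S T : prunes S T -> exists e : hom (tree_ob S) (tree_ob T), epi e.
Proof.
elim=> [X|l ss ts _ IH]; first by exists (q _); apply: (q_epi axC).
by have [h eh _] := node_map (tree_node ss) (tree_node ts) IH; exists h.
Qed.

(** Equal objects have epimorphisms both ways, and pruning is antisymmetric. *)
Lemma tree_ob_inj : injective tree_ob.
Proof.
have H S T : tree_ob S = tree_ob T -> prunes S T.
  move=> E; have: exists e : hom (tree_ob S) (tree_ob T), epi e.
    by rewrite E; exists (idm _); apply/iso_epi/idm_iso.
  by case=> e; apply: epi_prunes.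
by move=> S T E; apply: prunes_antisym; apply: H.
Qed.

(** An address that leaves the tree is cut off where it does so, which makes the function total. The
    value is an [arrow_into] because its source is the object of the subtree only provably, by
    [occ_src]. *)
Fixpoint occ T a {struct T} : arrow_into (tree_ob T) :=
  match T return arrow_into (tree_ob T) with
  | Leaf => id_arrow_into (tree_ob (@Leaf L))
  | @Node _ l ts =>
      match a with
      | [::] => id_arrow_into (tree_ob (Node ts))
      | k :: b =>
          if insub k is Some i
          then @extend C (tree_ob (Node ts)) (ArrowInto (child ts i)) (occ (ts i) b)
          else id_arrow_into (tree_ob (Node ts))
      end
  end.

Lemma occ0 T : occ T [::] = id_arrow_into (tree_ob T).
Proof. by case: T. Qed.

Lemma occ_strong T a : strong_mono (arr (occ T a)).
Proof.
have sid X : strong_mono (idm X) by apply/iso_strong/idm_iso.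
elim: T a => [|l ts IH] [|k b] //=; case: insub => [i|] //=.
by apply: strong_cmp (IH _ _); apply: comp_strong (child_comp ts i).
Qed.

Lemma occ_src T a : is_pos T a -> src (occ T a) = tree_ob (subtree T a).
Proof. by elim: T a => [|l ts IH] [|k b] //=; case: insub => [i|] //=; apply: IH. Qed.

Lemma occ_arrow T a : is_pos T a ->
  exists u : hom (tree_ob (subtree T a)) (tree_ob T), ArrowInto u = occ T a.
Proof. by move/occ_src/arrow_into_src. Qed.

Lemma occ_surj T (i : arrow_into (tree_ob T)) : strong_mono (arr i) ->
  exists2 a, is_pos T a & occ T a = i.
Proof.
elim: T i => [|l ts IH] i si.
  by exists [::] => //; rewrite (is_id_src (strong_to_one axC si)).
have [idi|ni] := pselect (is_id (arr i)).
  by exists [::] => //; rewrite (is_id_src idi).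
have [k ck [w sw kw]] := exists_comp axC si ni.
have /(node_enumerates (tree_node ts)).2[p Ep] := ck; subst k.
have [b pb Eb] := IH p (ArrowInto w) sw.
exists (val p :: b); first by rewrite /= insub_ord.
by rewrite /= insub_ord Eb /extend /= kw arrow_into_eta.
Qed.

Lemma extend_neq_id X (i : arrow_into X) (w : arrow_into (src i)) :
  Comp i -> extend w <> id_arrow_into X.
Proof.
move=> ci E; have eid : epi (arr (id_arrow_into X)) by apply/iso_epi/idm_iso.
rewrite -E in eid; apply: (comp_nid ci).
exact: (epi_strong_id axC (epi_cancel eid) (comp_strong ci)).
Qed.

Lemma extend_comp_eq X (i k : arrow_into X) (w : arrow_into (src i)) (w' : arrow_into (src k)) :
  Comp i -> Comp k -> strong_mono (arr w) -> strong_mono (arr w') ->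
  extend w = extend w' -> i = k.
Proof.
case: w w' => A w [A' w'] ci ck sw sw' E; have EA := congr1 (@src _ _) E.
rewrite /= in EA; subst A'; move/arrow_into_inj: E => /= E.
exact: (comp_disjoint axC ci ck sw sw' E).
Qed.

Lemma occ_inj T a b : is_pos T a -> is_pos T b -> occ T a = occ T b -> a = b.
Proof.
elim: T a b => [|l ts IH] [|k a] [|k' b] //=.
- by case: insubP => // i _ _ _ _ /esym/extend_neq_id; case; apply: child_comp.
- by case: insubP => // i _ _ _ _ /extend_neq_id; case; apply: child_comp.
case: insubP => // i _ <-; case: insubP => // i' _ <- pa pb E.
have := extend_comp_eq (child_comp ts i) (child_comp ts i') (occ_strong _ _) (occ_strong _ _) E.
move/(node_enumerates (tree_node ts)).1 => Ei; subst i'; congr (_ :: _).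
apply: (IH i) => //; apply: (@extend_inj _ (tree_ob (Node ts)) (ArrowInto (child ts i))) => //.
exact: comp_strong (child_comp ts i).
Qed.

Lemma occ_cat S T a b (u : hom (tree_ob S) (tree_ob T)) :
  is_pos T a -> subtree T a = S -> ArrowInto u = occ T a ->
  ArrowInto (u ∘ arr (occ S b)) = occ T (a ++ b).
Proof.
move=> + E; subst S; elim: T a u => [|l ts IH] [|k a] //= u.
- by move=> _ /arrow_into_inj ->; rewrite cmp1m.
- by move=> _ /arrow_into_inj ->; rewrite cmp1m; apply: arrow_into_eta.
case: insubP u => // i _ _ /= u pa; have [v Ev] := occ_arrow pa.
rewrite -Ev /extend /= => /arrow_into_inj ->.
by rewrite -(IH _ _ _ pa Ev) /= cmpA.
Qed.

(** With [occ_strong] this is the normal factorization of e restricted to an occurrence; it is the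
    source of [longest_prefix] in the composition of tree morphisms. *)
Lemma occ_epi S T a (e : hom (tree_ob S) (tree_ob T)) : epi e -> is_pos S a ->
  exists2 e' : hom (src (occ S a)) (src (occ T (longest_prefix T a))), epi e' &
    e ∘ arr (occ S a) = arr (occ T (longest_prefix T a)) ∘ e'.
Proof.
elim: S T a e => [|l ss IH] T a e ee.
  case: a => // _; rewrite longest_prefix0 !occ0.
  by exists e; rewrite ?cmpm1 ?cmp1m.
case: T e ee => [|l' ts] e ee pa.
  rewrite longest_prefix_leaf occ0; exists (e ∘ arr (occ (Node ss) a)); last by rewrite cmp1m.
  by rewrite (to_one axC (_ ∘ _) (q _)); apply: (q_epi axC).
have [//|[ts' E _]] := prunes_nodeE (epi_prunes ee).
have El : l' = l by case: E.
subst l' => {E ts'}.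
case: a pa => [|k b] /=; first by exists e; rewrite ?cmpm1 ?cmp1m.
case Ek: (insub k : option 'I_(rank l)) => [i|] //= pb; rewrite Ek /=.
have etr : epi (root_map ts ∘ e) by apply: epi_cmp => //; case: (tree_node ts).
have Er := reduction_epi_unique etr (tree_node ss).1.
have [ei eei Ei] := node_epi_comps (tree_node ss) (tree_node ts) ee Er i.
have [e' ee' E'] := IH i (ts i) b ei eei pb.
by exists e' => //; rewrite cmpA Ei -[LHS]cmpA E' cmpA.
Qed.

(** Only the address of h enters: prunings are unique, and so is e by [epi_unique]. The following
    lemmas show that this relation is the graph of a bijection compatible with identities and
    composition. *)
Definition represents S T (f : hom (tree_ob S) (tree_ob T)) (h : tree_hom S T) : Prop :=
  exists (u : hom (tree_ob (subtree T (address h))) (tree_ob T)) e,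
    [/\ ArrowInto u = occ T (address h), epi e & f = u ∘ e].

Lemma occ_arrow_strong A T (u : hom A (tree_ob T)) a :
  ArrowInto u = occ T a -> strong_mono u.
Proof. by move=> E; have := occ_strong T a; rewrite -E. Qed.

Lemma exists_tree_hom S T (f : hom (tree_ob S) (tree_ob T)) : exists h, represents f h.
Proof.
have [M [e [m [ee sm E]]]] := A2 axC f.
have [a pa Ea] := @occ_surj T (ArrowInto m) sm.
have EM : tree_ob (subtree T a) = M by rewrite -occ_src // Ea.
subst M; exists (TreeHom pa (epi_prunes ee)).
by exists m, e; split.
Qed.

Lemma exists_represented S T (h : tree_hom S T) : exists f, represents f h.
Proof.
have [u Eu] := occ_arrow (address_pos h).
have [e ee] := prunes_epi (tree_hom_prunes h).
by exists (u ∘ e), u, e.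
Qed.

Lemma represents_fun S T (f : hom (tree_ob S) (tree_ob T)) (h h' : tree_hom S T) :
  represents f h -> represents f h' -> h = h'.
Proof.
move=> [u [e [Eu ee ->]]] [u' [e' [Eu' ee' E]]]; apply: tree_hom_inj.
have [g isog [ug _]] := factorization_unique ee (occ_arrow_strong Eu) ee'
  (occ_arrow_strong Eu') E.
apply: (@occ_inj T); rewrite ?address_pos // -Eu -Eu' -ug.
exact: (@arrow_into_cmp_id _ _ (ArrowInto u')) (iso_is_id axC isog).
Qed.

Lemma represents_inj S T (f f' : hom (tree_ob S) (tree_ob T)) (h : tree_hom S T) :
  represents f h -> represents f' h -> f = f'.
Proof.
move=> [u [e [Eu ee ->]]] [u' [e' [Eu' ee' ->]]].
by rewrite (epi_unique ee ee'); move: Eu'; rewrite -Eu => /arrow_into_inj ->.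
Qed.

Lemma represents_id S : represents (idm (tree_ob S)) (tree_id S).
Proof.
rewrite /represents /= subtree0 occ0; exists (idm _), (idm _).
by rewrite cmpm1; split=> //; apply/iso_epi/idm_iso.
Qed.

Lemma represents_cmp S T (W : tree L)
    (f : hom (tree_ob S) (tree_ob T)) (g : hom (tree_ob T) (tree_ob W))
    (h : tree_hom S T) (k : tree_hom T W) :
  represents f h -> represents g k -> represents (g ∘ f) (tree_cmp k h).
Proof.
move=> [u [e [Eu ee ->]]] [v [d [Ev ed ->]]].
set V := subtree W (address k) in v d Ev ed *.
have [x Ex] := occ_arrow (is_pos_longest_prefix V (address h)).
have := occ_epi ed (address_pos h); rewrite -Eu -Ex /= => -[c ec E].
have Ecat : subtree W (tree_cmp_address k h) = subtree V (longest_prefix V (address h)).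
  by rewrite /tree_cmp_address subtree_cat ?address_pos.
have := occ_cat (longest_prefix V (address h)) (address_pos k) erefl Ev.
rewrite -/V -Ex /= => Evx.
rewrite /represents /= Ecat; exists (v ∘ x).
by exists (c ∘ e); split=> //; [exact: epi_cmp|rewrite -!cmpA (cmpA d) E !cmpA].
Qed.

(** * Inputs and fillings *)

Lemma comp_lt_node X phi (rho : hom X (sval phi)) u (p p' : 'I_(rank phi)) :
  node rho u -> p < p' -> comp_lt one R (u p) (u p').
Proof.
move=> nu lt; have [er Hu] := nu.
have eq0 X0 : epi (q X0) by apply: (q_epi axC).
split; [exact: (Hu p).1|exact: (Hu p').1|].
exists (sval phi), rho, (ArrowInto (letter_point p)), (ArrowInto (letter_point p')).
have [phi1 [r [_ nphi]]] := svalP phi.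
split; split; try exact: letter_point_comp.
- by split=> //; left.
- exact: svalP.
- exists (q _); split=> //; first exact: (point_strong axC).
  exact: (Hu p).2.
- exists (q _); split=> //; first exact: (point_strong axC).
  exact: (Hu p').2.
- exact: letter_point_sorted.
Qed.

(** The reduction hidden in [comp_lt] must be rho, so [R] compares exactly [letter_point p] with
    [letter_point p']. *)
Lemma node_comp_lt X phi (rho : hom X (sval phi)) u (p p' : 'I_(rank phi)) :
  node rho u -> comp_lt one R (u p) (u p') -> p < p'.
Proof.
move=> nu [_ _ [N [r [k [k' [[red ck ck' lN] [sk sk' Rk]]]]]]].
have er : epi r by case: red => -[[]//|[_ E]] _; case: lN.
have Ephi := @node_letter_unique _ _ rho (exist _ N lN) r nu.1 er.
subst phi; have Er := @reduction_epi_unique _ (exist _ N lN) _ _ nu.1 er; subst r.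
have pointE p0 k0 : Comp k0 -> sigma rho (u p0) k0 -> k0 = ArrowInto (letter_point p0).
  move=> ck0 [e [_ _ E]].
  exact: (sigma_fun axC er (nu.2 p0).1 ck0 (letter_point_comp p0) E (nu.2 p0).2).
move: Rk; rewrite (pointE _ _ ck sk) (pointE _ _ ck' sk') => Rk.
have [irr tr _] := HR lN; have cp := @letter_point_comp (exist _ N lN).
have [//|lt|Epp] := ltngtP p p'.
  by case: (irr _ (cp p)); apply: tr Rk (letter_point_sorted lt); apply: cp.
by move/val_inj: Epp Rk => -> /(irr _ (cp p')).
Qed.

Lemma comp_lt_asym X (i i' : arrow_into X) : comp_lt one R i i' -> ~ comp_lt one R i' i.
Proof.
move=> H H'; have [ci ci' _] := H.
have [phi [rho [u nu]]] := exists_node (comp_neq_one axC ci).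
have /(node_enumerates nu).2[p Ep] := ci; have /(node_enumerates nu).2[p' Ep'] := ci'.
subst i i'; have := ltn_trans (node_comp_lt nu H) (node_comp_lt nu H').
by rewrite ltnn.
Qed.

Lemma sub_lt_inv X (x y : arrow_into X) : sub_lt one R x y ->
  [\/ exists (i i' : arrow_into X) (w : arrow_into (src i)) (w' : arrow_into (src i')),
        [/\ comp_lt one R i i', S_ w, S_ w', x = extend w & y = extend w'],
      exists (i : arrow_into X) (w w' : arrow_into (src i)),
        [/\ Comp i, S_ w, S_ w', sub_lt one R w w' & x = extend w /\ y = extend w'] |
      exists (i : arrow_into X) (w : arrow_into (src i)),
        [/\ Comp i, S_ w, x = extend w & y = id_arrow_into X]].
Proof.
case=> {X x y}[X i i' w w' _ lt sw sw'|X i w w' _ ci sw sw' lt|X i w _ ci sw].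
- by constructor 1; exists i, i', w, w'.
- by constructor 2; exists i, w, w'.
- by constructor 3; exists i, w.
Qed.

(** Components are disjoint, so a proper subobject determines its component and the clauses of the
    order cannot conflict. Asymmetry gives both the absence of repetitions and the uniqueness of
    input lists. *)
Lemma sub_lt_asym X (x y : arrow_into X) : sub_lt one R x y -> sub_lt one R y x -> False.
Proof.
elim=> {X x y}[X i i' w w' _ lt sw sw'|X i w w' _ ci sw sw' _ IH|X i w _ ci sw] /sub_lt_inv.
- have [ci ci' _] := lt.
  case=> [[k [k' [v [v' [lt' sv sv' E E']]]]]|[k [v [v' [ck sv sv' _ [E E']]]]]|[k [v [ck sv E E']]]].
  + have [ck ck' _] := lt'.
    move: lt'; rewrite -(extend_comp_eq ci' ck sw' sv E) -(extend_comp_eq ci ck' sw sv' E').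
    exact: comp_lt_asym lt.
  + move: lt; rewrite (extend_comp_eq ci ck sw sv' E') (extend_comp_eq ci' ck sw' sv E) => lt.
    exact: comp_lt_asym (lt) (lt).
  + exact: (extend_neq_id ci E').
- case=> [[k [k' [v [v' [lt' sv sv' E E']]]]]|[k [v [v' [ck sv sv' lt [E E']]]]]|[k [v [ck sv E E']]]].
  + have [ck ck' _] := lt'.
    move: lt'; rewrite -(extend_comp_eq ci ck sw' sv E) -(extend_comp_eq ci ck' sw sv' E') => lt.
    exact: comp_lt_asym (lt) (lt).
  + have Ek := extend_comp_eq ci ck sw' sv E; subst k; apply: IH.
    have si := comp_strong ci.
    by rewrite (extend_inj si E) (extend_inj si E').
  + exact: (extend_neq_id ci E').
- case=> [[k [k' [v [v' [[ck _ _] sv sv' E E']]]]]|[k [v [v' [ck sv sv' _ [E _]]]]]|[k [v [ck sv E E']]]].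
  + exact: (extend_neq_id ck (esym E)).
  + exact: (extend_neq_id ck (esym E)).
  + exact: (extend_neq_id ci E').
Qed.

Lemma occ_leaf_addresses_sorted T :
  StronglySorted (sub_lt one R (X := tree_ob T)) [seq occ T a | a <- leaf_addresses T].
Proof.
elim: T => [|l ts IH]; first by do 2 constructor.
rewrite [leaf_addresses _]/= map_flatten -map_comp.
have X1 := @tree_ob_node_neq_one l ts.
have childE (i : 'I_(rank l)) a : occ (Node ts) (val i :: a) =
    @extend C (tree_ob (Node ts)) (ArrowInto (child ts i)) (occ (ts i) a).
  by rewrite /= insub_ord.
apply: StronglySorted_flatten => [i|i j x y ij].
  elim: (leaf_addresses (ts i)) (IH i) => [|a la IHla] H; first by constructor.
  have [sS Ha] := StronglySorted_inv H; constructor; first exact: IHla.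
  elim: la Ha {IHla sS H} => [|b la IHla] H; first by constructor.
  inversion H as [|? ? lt Hla]; subst; constructor; last exact: IHla.
  by rewrite !childE; apply: sub_lt_within => //;
    [exact: child_comp|exact: occ_strong|exact: occ_strong].
rewrite /= -!map_comp => /List.in_map_iff[a [<- _]] /List.in_map_iff[b [<- _]] /=.
rewrite !insub_ord; apply: sub_lt_across => //; try exact: occ_strong.
exact: (comp_lt_node (tree_node ts)).
Qed.

Lemma point_occ T (j : hom one (tree_ob T)) :
  exists2 a, a \in leaf_addresses T & occ T a = ArrowInto j.
Proof.
have [a pa Ea] := @occ_surj T (ArrowInto j) (point_strong axC j).
exists a => //; apply/mem_leaf_addresses; split=> //; apply: tree_ob_inj.
by rewrite -occ_src // Ea.
Qed.

Lemma leaf_address_occ T a : a \in leaf_addresses T ->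
  exists j : hom one (tree_ob T), ArrowInto j = occ T a.
Proof.
by case/mem_leaf_addresses => pa Ea; apply: arrow_into_src; rewrite occ_src // Ea.
Qed.

Lemma occ_inputs T (js : seq (hom one (tree_ob T))) :
  [seq ArrowInto j | j <- js] = [seq occ T a | a <- leaf_addresses T] -> inputs R js.
Proof.
move=> E; have sS : StronglySorted (fun j k => sub_lt one R (ArrowInto j) (ArrowInto k)) js.
  by apply: StronglySorted_map; rewrite E; apply: occ_leaf_addresses_sorted.
split=> // [|j].
  by apply: StronglySorted_NoDup sS => j lt; apply: (sub_lt_asym lt).
have [a la Ea] := point_occ j.
have : List.In (ArrowInto j) [seq ArrowInto j | j <- js].
  rewrite E -Ea; apply/List.in_map_iff; exists a; split=> //.
  elim: (leaf_addresses T) la => //= b s IH; rewrite inE => /orP[/eqP ->|/IH]; first by left.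
  by right.
by case/List.in_map_iff => k [/arrow_into_inj -> ].
Qed.

Lemma exists_tree_inputs T : exists js : seq (hom one (tree_ob T)),
  [seq ArrowInto j | j <- js] = [seq occ T a | a <- leaf_addresses T].
Proof.
have: forall a, a \in leaf_addresses T -> a \in leaf_addresses T by [].
elim: {1 3}(leaf_addresses T) => [|a s IH] H; first by exists [::].
have [|js Ejs] := IH; first by move=> b bs; apply: H; rewrite inE bs orbT.
have [|j Ej] := @leaf_address_occ T a; first by apply: H; rewrite inE eqxx.
by exists (j :: js); rewrite /= Ej Ejs.
Qed.

Lemma inputs_unique X (js ks : seq (hom one X)) : inputs R js -> inputs R ks -> js = ks.
Proof.
move=> [sj _ allj] [sk _ allk]; apply: StronglySorted_unique sj sk _ => [j k|j].
  exact: sub_lt_asym.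
by split.
Qed.

Lemma inputs_occ T (js : seq (hom one (tree_ob T))) : inputs R js ->
  [seq ArrowInto j | j <- js] = [seq occ T a | a <- leaf_addresses T].
Proof.
by have [ks Eks] := exists_tree_inputs T => /inputs_unique/(_ (occ_inputs Eks)) ->.
Qed.

Lemma exists_inputs X : exists js : seq (hom one X), inputs R js.
Proof.
have [T <-] := tree_ob_surj X; have [js Ejs] := exists_tree_inputs T.
by exists js; apply: occ_inputs.
Qed.

Lemma inputs_card X (js : seq (hom one X)) : inputs R js ->
  ([set: hom one X] #= `I_(size js))%card.
Proof.
move=> [_ nd all]; apply: (@enumerates_card_eq _ _ _ (tnth (in_tuple js))).
split=> [p p'|j]; last first.
  split=> // _; have [i lt <-] := nth_In j (all j).
  by exists (Ordinal lt); rewrite (tnth_nth j).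
have x0 := tnth (in_tuple js) p; rewrite !(tnth_nth x0) => E; apply: val_inj.
exact: NoDup_nth_inj nd (ltn_ord p) (ltn_ord p') E.
Qed.

Lemma inputs_size T (js : seq (hom one (tree_ob T))) : inputs R js -> size js = leaves T.
Proof.
by move/inputs_occ/(congr1 size); rewrite !size_map size_leaf_addresses.
Qed.

Lemma size_longest_prefix T a : size (longest_prefix T a) <= size a.
Proof. by elim: T a => [|l ts IH] [|k b] //=; case: insub => [i|] //=; rewrite ltnS IH. Qed.

Lemma prunes_pos S T a : prunes S T -> is_pos T a -> is_pos S a.
Proof.
move=> H; elim: H a => [X|l xs ts _ IH] [|k b] //=; first by rewrite is_pos0.
by case: insub => [i|] //; apply: IH.
Qed.

(** The fibre is the occurrence at some address a whose longest prefix in T is c. The occurrence of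
    S at c also maps to j and so factors through the fibre, which makes a a prefix of c. Comparing
    lengths gives a = c. *)
Lemma point_fibre S T (e : hom (tree_ob S) (tree_ob T)) c (j : hom one (tree_ob T))
    P (p : hom P (tree_ob S)) (r : hom P one) :
  epi e -> is_pos T c -> occ T c = ArrowInto j -> is_pullback e j p r ->
  ArrowInto p = occ S c.
Proof.
move=> ee pc Ec pb; have [E U] := pb.
have [a pa Ea] := @occ_surj S (ArrowInto p) (pullback_strong pb (point_strong axC j)).
have pSc := prunes_pos (epi_prunes ee) pc.
have Elp : longest_prefix T a = c.
  have [e1 ee1 E1] := occ_epi ee pa; rewrite Ea /= in e1 ee1 E1.
  have er : epi r by rewrite (to_one axC r (q _)); apply: (q_epi axC).
  rewrite E1 in E.
  have [h isoh [hj _]] := factorization_unique ee1 (occ_strong _ _) er (point_strong axC j) E.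
  apply: (@occ_inj T) => //; first exact: is_pos_longest_prefix.
  by rewrite Ec -(arrow_into_cmp_id (k := ArrowInto j) (iso_is_id axC isoh)) /= hj arrow_into_eta.
have [w Ew] := occ_arrow pSc.
have [x px] : exists x, p ∘ x = w.
  have := occ_epi ee pSc; rewrite (longest_prefix_id pc) -Ew Ec /= => -[e' _ Ee'].
  by have [x [[px _] _]] := U _ _ _ Ee'; exists x.
have EP : tree_ob (subtree S a) = P by rewrite -occ_src // Ea.
subst P.
have sx : strong_mono x.
  by apply: (@strong_cancel _ _ _ _ p); rewrite px; apply: occ_arrow_strong Ew.
have [b pb' Eb] := @occ_surj (subtree S a) (ArrowInto x) sx.
have := occ_cat b pa erefl (esym Ea).
rewrite Eb /= px Ew => /(occ_inj pSc (is_pos_cat pa pb')) Eab.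
have := size_longest_prefix T a; rewrite Elp Eab size_cat -[leqRHS]addn0 leq_add2l leqn0 size_eq0.
by move/eqP => ->; rewrite cats0 -Ea.
Qed.

Lemma occ_cat_inputs A S T a (u : hom A (tree_ob T)) (ks : seq (hom one A)) :
  tree_ob S = A -> is_pos T a -> subtree T a = S -> ArrowInto u = occ T a -> inputs R ks ->
  [seq ArrowInto (u ∘ k) | k <- ks] = [seq occ T (a ++ b) | b <- leaf_addresses S].
Proof.
move=> EA pa ES Eu Hks; subst A.
rewrite -(eq_map (fun b => occ_cat b pa ES Eu)).
rewrite (map_comp (fun x => ArrowInto (u ∘ arr x)) (occ S)) -(inputs_occ Hks).
by rewrite -map_comp.
Qed.

(** * Grafting as universal filling *)

Section Graft.
Variables (T : tree L) (n : nat) (js : n.-tuple (hom one (tree_ob T))) (As : n.-tuple C).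
Variable t : C -> tree L.
Hypothesis tK : forall X, tree_ob (t X) = X.
Hypothesis inputs_js : inputs R js.

Let G := graft T [seq t A | A <- As].
Let addr (i : 'I_n) := nth [::] (leaf_addresses T) i.

Let size_leaves : leaves T = n.
Proof. by rewrite -(inputs_size inputs_js) size_tuple. Qed.

Let size_As : size [seq t A | A <- As] = leaves T.
Proof. by rewrite size_map size_tuple. Qed.

Let addr_mem i : addr i \in leaf_addresses T.
Proof. by rewrite mem_nth // size_leaf_addresses size_leaves. Qed.

Let addr_pos i : is_pos T (addr i).
Proof. by case/mem_leaf_addresses: (addr_mem i). Qed.

Let js_occ i : occ T (addr i) = ArrowInto (tnth js i).
Proof.
rewrite (tnth_nth (tnth js i)) -(nth_map _ (occ T (addr i)) (@ArrowInto C (tree_ob T) one)) ?size_tuple //.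
by rewrite (inputs_occ inputs_js) (nth_map [::]) // size_leaf_addresses size_leaves.
Qed.

Let subtree_addr i : subtree G (addr i) = t (tnth As i).
Proof.
rewrite -(nth_map _ (@Leaf L) (subtree G)) ?size_leaf_addresses ?size_leaves //.
rewrite subtrees_graft // (nth_map (tnth As i)) ?size_tuple //.
by rewrite -tnth_nth.
Qed.

Let pos_G i : is_pos G (addr i).
Proof. exact: prunes_pos (graft_prunes _ _) (addr_pos i). Qed.

Lemma graft_filling : exists (d : hom (tree_ob G) (tree_ob T))
    (u : forall i : 'I_n, hom (tnth As i) (tree_ob G)),
  is_filling q (tnth js) d u /\ forall i, ArrowInto (u i) = occ G (addr i).
Proof.
have [d ed] := prunes_epi (graft_prunes T [seq t A | A <- As]).
have Hu i : exists u : hom (tnth As i) (tree_ob G), ArrowInto u = occ G (addr i).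
  by apply: arrow_into_src; rewrite occ_src // subtree_addr tK.
pose u i := projT1 (cid (Hu i)).
have Eu i : ArrowInto (u i) = occ G (addr i) by apply: (projT2 (cid (Hu i))).
exists d, u; split=> //; split=> // i; split; first exact: occ_arrow_strong (Eu i).
have [P [p [r [pb _]]]] := A3 axC ed (point_strong axC (tnth js i)).
have Ep := point_fibre ed (addr_pos i) (js_occ i) pb; rewrite -(Eu i) in Ep.
have EP := congr1 (@src _ _) Ep; rewrite /= in EP; subst P.
by move/arrow_into_inj: Ep pb => ->; rewrite (to_one axC r (q _)).
Qed.

Lemma graft_universal (d : hom (tree_ob G) (tree_ob T))
    (u : forall i : 'I_n, hom (tnth As i) (tree_ob G)) :
  is_filling q (tnth js) d u -> (forall i, ArrowInto (u i) = occ G (addr i)) ->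
  universal_filling q (tnth js) d u.
Proof.
move=> fill Eu; split=> // D' d' u' [ed' Hu'].
have [S ES] := tree_ob_surj D'; subst D'.
have Eu' i : ArrowInto (u' i) = occ S (addr i).
  exact: point_fibre ed' (addr_pos i) (js_occ i) (Hu' i).2.
have EG : S = G.
  rewrite -(graft_subtrees (epi_prunes ed')); congr graft.
  apply: (@eq_from_nth _ (@Leaf L)); first by rewrite size_map size_leaf_addresses size_As.
  move=> i; rewrite size_map size_leaf_addresses size_leaves => lt.
  pose k := Ordinal lt; rewrite (nth_map [::]) ?size_leaf_addresses ?size_leaves //.
  have -> : nth (@Leaf L) [seq t A | A <- As] i = t (tnth As k).
    by rewrite (nth_map (tnth As k)) ?size_tuple // [in RHS](tnth_nth (tnth As k)).
  apply: tree_ob_inj; rewrite tK -[nth _ _ i]/(addr k) -occ_src -?Eu' //.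
  exact: prunes_pos (epi_prunes ed') (addr_pos k).
subst S; have [ed _] := fill.
have Ed : d' = d by apply: epi_unique.
have Euu i : u' i = u i by apply: arrow_into_inj; rewrite Eu Eu'.
exists (idm _); split=> [|h [dh hu]]; first by split=> [|i]; rewrite ?cmpm1 ?cmp1m ?Ed.
(* [epi_restriction_id] requires a target other than [one]. In the remaining case the only input is
   the root, so [u] there is an identity and determines h. *)
have [T1|T1] := pselect (T = @Leaf L).
  have n1 : 0 < n by rewrite -size_leaves T1.
  have := Eu (Ordinal n1); rewrite /addr /= T1 /= occ0 => E0.
  have eu : epi (arr (ArrowInto (u (Ordinal n1)))) by rewrite E0; apply/iso_epi/idm_iso.
  by apply: eu; rewrite cmp1m /= -[LHS]hu Euu.
have TX : tree_ob T <> one by move/tree_ob_one.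
have [M [e [m [ee sm hE]]]] := A2 axC h.
have idm_m : is_id m.
  apply: (epi_restriction_id axC ed TX sm); apply: (@epi_cancel _ _ _ _ _ e).
  by rewrite -cmpA -hE dh Ed.
apply: epi_unique; first exact/iso_epi/idm_iso.
by rewrite hE; apply: epi_cmp => //; apply/iso_epi/is_id_iso.
Qed.

Lemma graft_inputs (u : forall i : 'I_n, hom (tnth As i) (tree_ob G))
    (ks : forall i, seq (hom one (tnth As i))) :
  (forall i, ArrowInto (u i) = occ G (addr i)) -> (forall i, inputs R (ks i)) ->
  inputs R (flatten [seq [seq u i ∘ k | k <- ks i] | i <- enum 'I_n]).
Proof.
move=> Eu Hks; apply: occ_inputs.
rewrite map_flatten -map_comp leaf_addresses_graft // map_flatten -map_comp.
rewrite (@zip_nth_enum _ _ [::] (@Leaf L) _ _ n) ?size_leaf_addresses ?size_As ?size_leaves //.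
rewrite -map_comp; congr flatten; apply: eq_map => i /=; rewrite -!map_comp.
rewrite (nth_map (tnth As i)) ?size_tuple // -tnth_nth.
exact: occ_cat_inputs (tK _) (pos_G i) (subtree_addr i) (Eu i) (Hks i).
Qed.

End Graft.

End LetterNodes.

(** * Operads *)

Section OperadIsomorphisms.

Lemma operad_map_id T (O : operad T) : operad_map O O id.
Proof. by split=> // x ys _; rewrite map_id. Qed.

Lemma operad_map_comp T U V (O : operad T) (P : operad U) (Q : operad V) g f :
  operad_map O P f -> operad_map P Q g -> operad_map O Q (g \o f).
Proof.
move=> [fa f1 fc] [ga g1 gc]; split=> [x||x ys sy] /=; first by rewrite ga fa.
  by rewrite f1 g1.
by rewrite fc // gc ?size_map ?fa // -map_comp.
Qed.

Lemma operad_isomorphic_trans U T V (O : operad T) (P : operad U) (Q : operad V) :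
  operad_isomorphic O P -> operad_isomorphic P Q -> operad_isomorphic O Q.
Proof.
move=> [f [mf [g mg [fK gK]]]] [f' [mf' [g' mg' [fK' gK']]]].
exists (f' \o f); split; first exact: operad_map_comp mf mf'.
exists (g \o g'); first exact: operad_map_comp mg' mg.
by split; [exact: can_comp|exact: can_comp].
Qed.

Lemma is_free_iso (L : ranked_set) T U (O : operad T) (P : operad U) f
    (iota : L -> T) (kappa : L -> U) :
  operad_iso O P f -> (forall l, f (iota l) = kappa l) -> is_free P kappa -> is_free O iota.
Proof.
move=> [mf [g mg [fK gK]]] E [kinj kar kfree]; split=> [l l' El|l|V Q h Hh].
- by apply: kinj; rewrite -!E El.
- by case: mf => <- _ _; rewrite E.
have [F [mF FE] FU] := kfree _ Q h Hh.
exists (F \o f) => [|G mG GE x].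
  by split=> [|l]; [exact: operad_map_comp mf mF|rewrite /= E].
rewrite /= -(FU (G \o g)) /= ?fK // => [|l]; first exact: operad_map_comp mg mG.
by rewrite -E fK.
Qed.

(** The two sets of letters may differ by an arity-preserving bijection, as is needed when the
    letters of a given free operad are matched with derived ones. *)
Lemma free_operads_isomorphic (L M : ranked_set) T U (O : operad T) (P : operad U)
    (iota : L -> T) (kappa : M -> U) (g : L -> M) (h : M -> L) :
  is_free O iota -> is_free P kappa -> cancel g h -> cancel h g ->
  (forall l, rank (g l) = rank l) -> operad_isomorphic O P.
Proof.
move=> [_ Oar Ofree] [_ Par Pfree] gK hK rg.
have [|F [mF FE] _] := Ofree _ P (kappa \o g); first by move=> l; rewrite /= Par rg.
have [|G [mG GE] _] := Pfree _ O (iota \o h); first by move=> m; rewrite /= Oar -rg hK.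
have [I _ IU] := Ofree _ O iota Oar; have [J _ JU] := Pfree _ P kappa Par.
exists F; split=> //; exists G => //; split=> x.
  rewrite -[LHS]/((G \o F) x) (IU (G \o F)) -?(IU id) //=.
  - exact: operad_map_id.
  - exact: operad_map_comp mF mG.
  - by move=> l; rewrite /= FE /= GE /= gK.
rewrite -[LHS]/((F \o G) x) (JU (F \o G)) -?(JU id) //=.
- exact: operad_map_id.
- exact: operad_map_comp mG mF.
- by move=> l; rewrite /= GE /= FE /= hK.
Qed.

End OperadIsomorphisms.

(** * Transport of an operad along a bijection *)

Section Transport.
Variables (T U : Type) (O : operad T) (s : T -> U) (t : U -> T).
Hypotheses (sK : cancel s t) (tK : cancel t s).

Let tar x := arity O (t x).
Let tcomp x ys := s (ocomp O (t x) [seq t y | y <- ys]).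

Let arity_tunit : tar (s (ounit O)) = 1.
Proof. by rewrite /tar sK arity_ounit. Qed.

Let arity_tcomp x ys : size ys = tar x -> tar (tcomp x ys) = sumn [seq tar y | y <- ys].
Proof. by move=> E; rewrite /tar /tcomp sK arity_ocomp ?size_map // -map_comp. Qed.

Let tcomp1x x : tcomp (s (ounit O)) [:: x] = x.
Proof. by rewrite /tcomp /= sK ocomp1x tK. Qed.

Let tcompx1 x : tcomp x (nseq (tar x) (s (ounit O))) = x.
Proof. by rewrite /tcomp map_nseq sK ocompx1 tK. Qed.

Let tcompA x ys zss : size ys = tar x -> shape zss = [seq tar y | y <- ys] ->
  tcomp (tcomp x ys) (flatten zss) = tcomp x [seq tcomp p.1 p.2 | p <- zip ys zss].
Proof.
move=> sy sz; rewrite /tcomp sK map_flatten ocompA ?size_map //; last first.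
  rewrite -[RHS]map_comp -sz /shape -map_comp; apply: eq_map => z /=.
  by rewrite size_map.
congr (s (ocomp _ _ _)); elim: ys zss {sy sz} => [|y ys IH] [|z zss] //=.
by rewrite IH sK.
Qed.

Definition operad_transport : operad U :=
  Operad arity_tunit arity_tcomp tcomp1x tcompx1 tcompA.

Lemma operad_transport_iso : operad_iso operad_transport O t.
Proof.
split; first by split=> // [|x ys _] /=; rewrite ?/tcomp sK.
exists s => //; split=> [x||x ys sy] //=; first by rewrite /tar sK.
rewrite /tcomp sK -map_comp; congr (s (ocomp _ _ _)).
by rewrite -[LHS]map_id; apply: eq_map => y /=; rewrite sK.
Qed.

End Transport.

(** * Isomorphisms of categories given by their inverse *)

Section InverseIsomorphism.
Variables (C D : category) (F : D -> C) (t : C -> D).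
Hypothesis tK : forall X, F (t X) = X.
Variable Gm : forall S T : D, hom (F S) (F T) -> hom S T.
Hypothesis Gm_bij : forall S T, bijective (@Gm S T).
Hypothesis Gm1 : forall S, Gm (idm (F S)) = idm S.
Hypothesis GmM : forall S T W (g : hom (F T) (F W)) (f : hom (F S) (F T)),
  Gm (g ∘ f) = Gm g ∘ Gm f.

(** [F (t X)] equals X only propositionally. With both equalities as variables, the facts about this
    transport follow by substitution. *)
Let cast (X X' Y Y' : C) (EX : X' = X) (EY : Y' = Y) (f : hom X Y) : hom X' Y' :=
  eq_rect_r (fun Z => hom Z Y') (eq_rect_r (fun Z => hom X Z) f EY) EX.

Lemma cat_isomorphic_inverse : cat_isomorphic C (full_category t).
Proof.
pose c (X Y : C) (f : hom X Y) : hom (F (t X)) (F (t Y)) := cast (tK X) (tK Y) f.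
have cast_bij (X X' Y Y' : C) (EX : X' = X) (EY : Y' = Y) :
    bijective (cast EX EY : hom X Y -> hom X' Y').
  by subst X' Y'; exists id.
have cast1 (X X' : C) (EX : X' = X) : cast EX EX (idm X) = idm X' by subst X'.
have castM (X X' Y Y' Z Z' : C) (EX : X' = X) (EY : Y' = Y) (EZ : Z' = Z) (g : hom Y Z) (f : hom X Y) :
    cast EX EZ (g ∘ f) = cast EY EZ g ∘ cast EX EY f by subst X' Y' Z'.
exists id, (fun X Y f => Gm (c X Y f)); split=> [|X Y|X|X Y Z g f].
- by exists id.
- by apply: bij_comp (Gm_bij _ _) _; apply: cast_bij.
- by rewrite /c cast1 Gm1.
- by rewrite /c (castM _ _ _ _ _ _ _ (tK Y)) GmM.
Qed.

End InverseIsomorphism.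

Section FillingOperads.
Variables (C : category) (one : C) (q : forall X : C, hom X one).
Hypothesis axC : nine_axioms q.
Implicit Types X Y Z A B : C.

Section Existence.
Variable R : forall phi : C, arrow_into phi -> arrow_into phi -> Prop.
Hypothesis HR : linear_orders one R.

Local Notation L := (derived_ranked_set one).
Local Notation tree_ob := (tree_ob axC HR).

Lemma tree_ob_corolla (l : L) : tree_ob (corolla l) = letter_object l.
Proof.
have nl : node axC HR (idm (sval l)) (fun p => ArrowInto (letter_point axC HR p)).
  split=> [|p]; first exact/iso_epi/idm_iso.
  split; first exact: letter_point_comp.
  by rewrite cmp1m /= (to_one axC (q one) (idm one)) cmpm1.
have [|g isog _] := node_unique (@tree_node _ _ _ axC _ HR l (fun _ => @Leaf L)) nl; first by [].
exact: is_id_ob (iso_is_id axC isog).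
Qed.

Lemma filling_operad_exists : exists O : operad C,
  [/\ is_filling_operad q R O, is_free O (@letter_object C one) &
      is_matching_category C O (@letter_object C one)].
Proof.
have /choice[t tK] : forall X, exists T, tree_ob T = X by exact: tree_ob_surj.
have sK : cancel tree_ob t by move=> T; apply: (tree_ob_inj (axC := axC) (HR := HR)); rewrite tK.
pose O := operad_transport (tree_operad L) sK tK.
have isoO : operad_iso O (tree_operad L) t by apply: operad_transport_iso.
have tl l : t (letter_object l) = corolla l by rewrite -tree_ob_corolla sK.
exists O; split.
- split=> [X n|//|X|X n js As].
  + have [T <-] : exists T, tree_ob T = X by exists (t X).
    have [js Hjs] := exists_inputs axC HR (tree_ob T).
    have := inputs_card Hjs; rewrite (inputs_size Hjs) /= sK => Hc.
    split=> [<- //|Hn]; apply/(@card_eq_II (leaves T) n).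
    by rewrite -(card_eql Hc).
  + exact: (exists_inputs axC HR X).
  + have [T ET] : exists T, tree_ob T = X by exists (t X); apply: tK.
    subst X => Hjs; rewrite /= sK.
    have [d [u [fill Eu]]] := graft_filling As tK Hjs.
    exists d, u; split; first exact: (graft_universal tK Hjs fill Eu).
    by move=> ks Hks; exact: (graft_inputs tK Hjs Eu Hks).
- exact: is_free_iso isoO tl (tree_operad_free L).
- exists t; split=> //.
  have Gex S T (f : hom (tree_ob S) (tree_ob T)) : {h : tree_hom S T | represents f h}.
    by apply: cid; apply: exists_tree_hom.
  pose Gm S T (f : hom (tree_ob S) (tree_ob T)) : hom (c := tree_category L) S T :=
    sval (Gex S T f).
  have GmP S T f : represents f (Gm S T f) by apply: (svalP (Gex S T f)).
  apply: (@cat_isomorphic_inverse C (tree_category L) tree_ob t tK Gm).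
  + move=> S T; exists (fun h => projT1 (cid (exists_represented axC HR h))) => [f|h].
      case: cid => f' Hf' /=; exact: represents_inj Hf' (GmP _ _ _).
    case: cid => f Hf /=; exact: represents_fun (GmP _ _ _) Hf.
  + by move=> S; apply: represents_fun (GmP _ _ _) (represents_id _ _ _).
  + move=> S T W g f; apply: represents_fun (GmP _ _ _) _.
    exact: represents_cmp.
Qed.

End Existence.

Lemma universal_filling_unique (I : Type) B (j : I -> hom one B) (A : I -> C)
    D (d : hom D B) (u : forall i, hom (A i) D) D' (d' : hom D' B) (u' : forall i, hom (A i) D') :
  universal_filling q j d u -> universal_filling q j d' u' -> D = D'.
Proof.
move=> [fD U] [fD' U'].
have [h [[dh hu] _]] := U' _ _ _ fD; have [k [[dk ku] _]] := U _ _ _ fD'.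
have [x [_ Ux]] := U _ _ _ fD; have [y [_ Uy]] := U' _ _ _ fD'.
apply: (is_id_ob (iso_is_id axC (f := h) _)); exists k; split.
  rewrite -(Ux (idm D)) ?(Ux (k ∘ h)) //; last by split=> [|i]; rewrite ?cmpm1 ?cmp1m.
  by split=> [|i]; rewrite ?cmpA ?dk // -cmpA hu ku.
rewrite -(Uy (idm D')) ?(Uy (h ∘ k)) //; last by split=> [|i]; rewrite ?cmpm1 ?cmp1m.
by split=> [|i]; rewrite ?cmpA ?dh // -cmpA ku hu.
Qed.

(** The order determines the operad: arities count points, and composites are universal fillings,
    which are unique as objects. *)
Lemma filling_operad_map R (O O' : operad C) : linear_orders one R ->
  is_filling_operad q R O -> is_filling_operad q R O' -> operad_map O O' id.
Proof.
move=> HR HO HO'; split=> [X||X As sAs].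
- exact/(filling_arity HO' X _)/(filling_arity HO X _).
- by rewrite (filling_ounit HO) (filling_ounit HO').
have [js Hjs] := filling_inputs HO X.
have Ejs : arity O X = size js by apply/(filling_arity HO X _); apply: inputs_card Hjs.
have /eqP tAs : size As = size js by rewrite sAs.
have [d [u [U _]]] := filling_ocomp HO (js := in_tuple js) (Tuple tAs) Hjs.
have [d' [u' [U' _]]] := filling_ocomp HO' (js := in_tuple js) (Tuple tAs) Hjs.
by rewrite map_id; apply: universal_filling_unique U U'.
Qed.

Lemma filling_operads_isomorphic R (O O' : operad C) : linear_orders one R ->
  is_filling_operad q R O -> is_filling_operad q R O' -> operad_isomorphic O O'.
Proof.
move=> HR HO HO'; exists id; split; first exact: filling_operad_map HR HO HO'.
by exists id; first exact: filling_operad_map HR HO' HO.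
Qed.

(** * Letters of an expression tree category *)

Section TreeCategory.
Variables (M : ranked_set) (F : C -> tree M).
Variable Fm : forall X Y, hom X Y -> tree_hom (F X) (F Y).
Hypotheses (F_bij : bijective F) (Fm_bij : forall X Y, bijective (@Fm X Y)).
Hypothesis Fm1 : forall X, Fm (idm X) = tree_id (F X).
Hypothesis FmM : forall X Y Z (g : hom Y Z) (f : hom X Y), Fm (g ∘ f) = tree_cmp (Fm g) (Fm f).

Let addr X Y (f : hom X Y) := address (Fm f).

Let addr_inj X Y (f g : hom X Y) : addr f = addr g -> f = g.
Proof. by move=> E; apply: (bij_inj (Fm_bij X Y)); apply: tree_hom_inj. Qed.

Let addr_ex X Y a : is_pos (F Y) a -> prunes (F X) (subtree (F Y) a) ->
  exists f : hom X Y, addr f = a.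
Proof.
move=> pa pr; have [G _ GK] := Fm_bij X Y.
by exists (G (TreeHom pa pr)); rewrite /addr GK.
Qed.

Let addr_root X Y : prunes (F X) (F Y) -> exists f : hom X Y, addr f = [::].
Proof. by move=> pr; apply: addr_ex; rewrite ?subtree0 // is_pos0. Qed.

Let addr1 X : addr (idm X) = [::].
Proof. by rewrite /addr Fm1. Qed.

Let addrM X Y Z (g : hom Y Z) (f : hom X Y) :
  addr (g ∘ f) = addr g ++ longest_prefix (subtree (F Z) (addr g)) (addr f).
Proof. by rewrite /addr FmM. Qed.

Let F_surj T : exists X, F X = T.
Proof. by have [G _ GK] := F_bij; exists (G T). Qed.

Let F_one : F one = @Leaf M.
Proof.
have [X FX] := F_surj (@Leaf M).
have [|j Ej] := @addr_root one X; first by rewrite FX; constructor.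
suff /is_id_ob -> : is_id j by [].
apply: (iso_is_id axC); exists (q X); split; first by apply: (to_one axC).
(* The root is the only position of a leaf, so X has a single endomorphism. *)
apply: addr_inj; have H (f : hom X X) : addr f = [::].
  by have := address_pos (Fm f); rewrite -/(addr f) FX; case: (addr f).
by rewrite !H.
Qed.

Let F_neq_leaf X : X <> one -> exists l ts, F X = @Node M l ts.
Proof.
case E: (F X) => [|l ts]; last by exists l, ts.
by case; apply: (bij_inj F_bij); rewrite F_one.
Qed.

(* A map with nonempty address lands below a child k of the root of Y, where
   pruning Y to a corolla agrees with the constant map at the k-th leaf. *)
Let epi_addr X Y (d : hom X Y) : epi d <-> addr d = [::].
Proof.
split=> [ed|E Z g h /(congr1 (@addr _ _))]; last first.
  by rewrite !addrM E !longest_prefix0 !cats0 => /addr_inj.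
case Ed: (addr d) => [|k b] //; exfalso.
have := address_pos (Fm d); rewrite -/(addr d) Ed.
case EY: (F Y) => [|l ts] //=; case: insubP => // i _ Ei _.
have [Z FZ] := F_surj (corolla l).
have [|g Eg] := @addr_root Y Z; first by rewrite FZ EY; constructor=> i'; constructor.
have [||h Eh] := @addr_ex Y Z [:: k].
- by rewrite FZ /= -Ei insub_ord.
- by rewrite FZ /= -Ei insub_ord; constructor.
suff /(congr1 (@addr _ _)) : g = h by rewrite Eg Eh.
apply: ed; apply: addr_inj; rewrite !addrM Eg Eh Ed FZ /= -Ei insub_ord /=.
by case: (b).
Qed.

(** Pruning to the corolla of the root label is an epimorphism with target other than [one], hence
    an identity on a normal object. Conversely, a corolla prunes only to itself and to the leaf. *)
Let letter_corolla X : is_letter one X <-> exists l, F X = corolla l.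
Proof.
split=> [[X1 [_ [_ nX]]]|[l FX]].
  have [l [ts FX]] := F_neq_leaf X1.
  have [Z FZ] := F_surj (corolla l); exists l; rewrite -FZ.
  have [|d Ed] := @addr_root X Z; first by rewrite FZ FX; constructor=> i; constructor.
  congr F; apply: is_id_ob (nX Z d _); left; split; first exact/epi_addr.
  by move=> Z1; move: FZ; rewrite Z1 F_one.
have X1 : X <> one by move=> E; move: FX; rewrite E F_one.
split=> //; exists (idm X); split; first by left; split=> //; apply/iso_epi/idm_iso.
move=> Y d [[/epi_addr Ed Y1]|[]//].
have [l' [zs FY]] := F_neq_leaf Y1.
have := tree_hom_prunes (Fm d); rewrite -/(addr d) Ed FX FY subtree0.
case/prunes_nodeE => // -[ts E Hts].
have Ets : Node ts = corolla l.
  by congr Node; apply/funext => i; apply: prunes_leafE; apply: Hts.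
have EXY : Y = X by apply: (bij_inj F_bij); rewrite FX FY E Ets.
by subst Y; have -> : d = idm X by apply: addr_inj; rewrite Ed addr1.
Qed.

(** The components of a letter are its points, and the points of a corolla are its addresses of
    length one. *)
Let letter_rank X l : F X = corolla l -> Defs.card (@Comp C X) = rank l.
Proof.
move=> FX; have /(letterP axC)[X1 HX] : is_letter one X by apply/letter_corolla; exists l.
apply: card_unique.
have /choice[pt Ept] : forall i : 'I_(rank l), exists j : hom one X, addr j = [:: val i].
  by move=> i; apply: addr_ex; rewrite FX /= insub_ord // F_one; constructor.
apply: (enumerates_card_eq (u := fun i => ArrowInto (pt i))); split=> [i i' /arrow_into_inj E|k].
  by have := Ept i; rewrite E Ept => -[] /val_inj.
split=> [ck|[i <-]].
  have [j Ej] := arrow_into_src (HX k ck); subst k.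
  have := address_pos (Fm j); have := tree_hom_prunes (Fm j); rewrite -/(addr j) F_one FX.
  case Ea: (addr j) => [|m b] /=.
    by move/prunes_leafE.
  case: insubP => //= i _ Ei _; case: b Ea => // Ea _; exists i.
  by congr ArrowInto; apply: addr_inj; rewrite Ept Ea -Ei.
have [k' ck [w kw]] := exists_comp_point axC (pt i) X1.
have Ek := HX k' ck; case: k' Ek ck w kw => A m /= EA; subst A => ck w <-.
by rewrite (to_one axC w (idm one)) cmpm1.
Qed.

Lemma letters_of_tree_category : exists (g : M -> derived_ranked_set one) h,
  [/\ cancel g h, cancel h g & forall l, rank (g l) = rank l].
Proof.
have /choice[g Hg] : forall l : M, exists phi : derived_ranked_set one, F (sval phi) = corolla l.
  move=> l; have [X FX] := F_surj (corolla l).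
  have lX : is_letter one X by apply/letter_corolla; exists l.
  by exists (exist _ X lX).
have /choice[h Hh] : forall phi : derived_ranked_set one, exists l, F (sval phi) = corolla l.
  by move=> phi; apply/letter_corolla/svalP.
exists g, h; split=> [l|phi|l]; last exact: letter_rank.
  by have := Hh (g l); rewrite Hg => -[].
by apply: letter_eq; apply: (bij_inj F_bij); rewrite Hg Hh.
Qed.

End TreeCategory.

Lemma matching_operad_recovered R (O : operad C) (M : ranked_set) T (P : operad T) (iota : M -> T) :
  linear_orders one R -> is_filling_operad q R O ->
  is_free P iota -> is_matching_category C P iota -> operad_isomorphic P O.
Proof.
move=> HR HO freeP [t [[_ [t' _ [tK t'K]]] _ [F [Fm [F_bij Fm_bij Fm1 FmM]]]]].
have [O0 [HO0 freeO0 _]] := filling_operad_exists HR.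
(* Through [t \o F] the category is isomorphic to the tree category of M itself, which identifies M
   with the derived letters. *)
have tF_bij : bijective (t \o F) by apply: bij_comp F_bij; exists t'.
have [g [h [gK hK rg]]] := letters_of_tree_category tF_bij Fm_bij Fm1 FmM.
apply: operad_isomorphic_trans (filling_operads_isomorphic HR HO0 HO).
exact: free_operads_isomorphic freeP freeO0 gK hK rg.
Qed.

(** Each operad is compared with the one constructed for its order; those two are free on the same
    ranked set, which does not depend on the orders. *)
Lemma filling_operad_order_independent R R' (O O' : operad C) :
  linear_orders one R -> linear_orders one R' ->
  is_filling_operad q R O -> is_filling_operad q R' O' -> operad_isomorphic O O'.
Proof.
move=> HR HR' HO HO'.
have [O0 [HO0 free0 _]] := filling_operad_exists HR.
have [O0' [HO0' free0' _]] := filling_operad_exists HR'.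
apply: operad_isomorphic_trans (filling_operads_isomorphic HR HO HO0) _.
apply: operad_isomorphic_trans (filling_operads_isomorphic HR' HO0' HO').
exact: (@free_operads_isomorphic _ _ _ _ _ _ _ _ id id free0 free0').
Qed.

End FillingOperads.

Unset Implicit Arguments.

Theorem theorem1p40 (C : category) (one : C) (q : forall X : C, hom X one)
    (axC : nine_axioms q) :
  (forall R : (forall phi : C, arrow_into phi -> arrow_into phi -> Prop),
     linear_orders one R ->
     exists O : operad C,
       [/\ is_filling_operad q R O,
           is_free O (@letter_object C one) &
           is_matching_category C O (@letter_object C one)]) /\
  (forall (R R' : forall phi : C, arrow_into phi -> arrow_into phi -> Prop)
          (O O' : operad C),
     linear_orders one R -> linear_orders one R' ->
     is_filling_operad q R O -> is_filling_operad q R' O' ->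
     operad_isomorphic O O') /\
  (forall (R : forall phi : C, arrow_into phi -> arrow_into phi -> Prop) (O : operad C),
     linear_orders one R -> is_filling_operad q R O ->
     forall (L : ranked_set) (T : Type) (P : operad T) (iota : L -> T),
       is_free P iota -> is_matching_category C P iota ->
       operad_isomorphic P O).
Proof.
split; first exact: filling_operad_exists.
split=> [R R' O O' HR HR' HO HO'|R O HR HO L T P iota freeP matchP].
  exact: (filling_operad_order_independent axC HR HR' HO HO').
exact: (matching_operad_recovered axC HR HO freeP matchP).
Qed.
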